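(* Let $n\ge 2$. There is a constant $\delta_0=\delta_0(n)>0$ with the following property. Let $F\subset S^{n-1}$ be a good Cantor set, i.e. a compact set such that $S^{n-1}\setminus F=\bigcup_{i\in\mathbb{N}}U_i$ is a disjoint union of open round balls $U_i$ of $S^{n-1}$ (standard metric) whose radii are bounded by $\delta_0$. Then there exist immersions $x:S^n\to\mathbb{R}^{n+1}$ such that $\operatorname{rank}(x)=n-1$, the Gauss–Kronecker curvature $H_n$ of $x$ is non-negative everywhere, and $\{p\in S^n: H_n(p)=0\}=F\times D^1$, where $D^1$ is a $1$-dimensional disk (here $F\times D^1$ is regarded as a subset of a closed band $S^{n-1}\times D^1\subset S^n$ around an equator $S^{n-1}$ of $S^n$).
   Context: For an immersion $x:M^n\to\mathbb{R}^{n+1}$ of an orientable manifold with Gauss map $N:M\to S^n$ (for a fixed orientation), the principal curvatures are the eigenvalues of the self-adjoint map $dN$, the Gauss–Kronecker curvature is $H_n=\det(dN)$, and $\operatorname{rank}(x):=\min_{p\in M}\operatorname{rank}(d_pN)$. *)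

(* Defs.v *)
From HB Require Import structures.
From mathcomp Require Import all_boot all_order all_algebra.
From mathcomp Require Import all_classical all_reals all_analysis.
Set Implicit Arguments. Unset Strict Implicit. Unset Printing Implicit Defensive.
Import Order.TTheory GRing.Theory Num.Theory.
Import numFieldNormedType.Exports.
Local Open Scope classical_set_scope.
Local Open Scope ring_scope.

Section Defs.
Variable R : realType.

Definition dot (m : nat) (u v : 'rV[R]_m) : R := \sum_(i < m) u 0 i * v 0 i.

Definition sphere (m : nat) : set 'rV[R]_m := [set p | dot p p = 1].

Definition sdist (m : nat) (p q : 'rV[R]_m) : R := acos (dot p q).

Definition sball (m : nat) (c : 'rV[R]_m) (r : R) : set 'rV[R]_m :=
  [set q | sphere q /\ sdist c q < r].

Definition good_cantor (m : nat) (delta : R) (F : set 'rV[R]_m) : Prop :=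
  compact F /\ F `<=` sphere (m := m) /\
  exists (c : nat -> 'rV[R]_m) (r : nat -> R),
    (forall i, sphere (c i) /\ 0 < r i /\ r i <= delta) /\
    (forall i j, i <> j -> sball (c i) (r i) `&` sball (c j) (r j) = set0) /\
    sphere (m := m) `\` F = \bigcup_i sball (c i) (r i).

(* radial projection R^m \ {0} -> S^(m-1): a map on S^(m-1) is smooth iff its
   composite with rad is smooth on R^m \ {0} *)
Definition rad (m : nat) (p : 'rV[R]_m) : 'rV[R]_m := (Num.sqrt (dot p p))^-1 *: p.

Fixpoint iterD (m k : nat) (vs : seq 'rV[R]_m) (f : 'rV[R]_m -> 'rV[R]_k)
  : 'rV[R]_m -> 'rV[R]_k :=
  if vs is v :: vs' then (fun y => 'D_v (iterD vs' f) y) else f.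

Definition smooth_off0 (m k : nat) (f : 'rV[R]_m -> 'rV[R]_k) : Prop :=
  forall vs : seq 'rV[R]_m,
    (forall y, y != 0 -> {for y, continuous (iterD vs f)}) /\
    (forall v y, y != 0 -> derivable (iterD vs f) y v).

Definition smooth_on_sphere (m k : nat) (f : 'rV[R]_m -> 'rV[R]_k) : Prop :=
  smooth_off0 (f \o @rad m).

Definition tproj (m : nat) (p w : 'rV[R]_m) : 'rV[R]_m := w - dot w p *: p.

Definition dsph (m k : nat) (f : 'rV[R]_m -> 'rV[R]_k) (p v : 'rV[R]_m) : 'rV[R]_k :=
  'D_v (f \o @rad m) p.

Definition immersion (m : nat) (x : 'rV[R]_m -> 'rV[R]_m) : Prop :=
  smooth_on_sphere x /\
  forall p, sphere p -> forall v, dot v p = 0 -> v != 0 -> dsph x p v != 0.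

Definition gauss_map (m : nat) (x N : 'rV[R]_m -> 'rV[R]_m) : Prop :=
  smooth_on_sphere N /\
  forall p, sphere p -> dot (N p) (N p) = 1 /\
    forall v, dot v p = 0 -> dot (N p) (dsph x p v) = 0.

Definition ev (m : nat) (i : 'I_m) : 'rV[R]_m := delta_mx 0 i.

(* matrix (rows = images of the spanning family tproj p e_i of T_p) of d_pN;
   its rank is rank(d_p N) *)
Definition dN_mx (m : nat) (N : 'rV[R]_m -> 'rV[R]_m) (p : 'rV[R]_m) : 'M[R]_m :=
  \matrix_(i < m) dsph N p (tproj p (ev i)).

Definition rank_dN (m : nat) (N : 'rV[R]_m -> 'rV[R]_m) (p : 'rV[R]_m) : nat :=
  \rank (dN_mx N p).

(* extensions to R^m sending p to N(p):  ext_dx = d_px (+) (p |-> N p),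
   ext_dN = d_pN (+) (p |-> N p).  Then ext_dN = A (+) id composed with ext_dx,
   where A = (d_px)^-1 o d_pN : T_p -> T_p is dN viewed as an endomorphism of
   T_p (identifying T_{N p} S = N(p)^perp = d_px(T_p)).  (row-vector convention) *)
Definition ext_dx (m : nat) (x N : 'rV[R]_m -> 'rV[R]_m) (p : 'rV[R]_m) : 'M[R]_m :=
  \matrix_(i < m) (dsph x p (tproj p (ev i)) + dot (ev i) p *: N p).

Definition ext_dN (m : nat) (N : 'rV[R]_m -> 'rV[R]_m) (p : 'rV[R]_m) : 'M[R]_m :=
  \matrix_(i < m) (dsph N p (tproj p (ev i)) + dot (ev i) p *: N p).

(* Gauss–Kronecker curvature H_n(p) = det(dN_p) = det(A (+) id) *)
Definition gauss_kronecker (m : nat) (x N : 'rV[R]_m -> 'rV[R]_m) (p : 'rV[R]_m) : R :=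
  \det (ext_dN N p *m invmx (ext_dx x N p)).

(* F x D^1 inside the band S^(n-1) x [-a,a] of S^n around the equator {p_0 = 0}:
   points (sin t, cos t * q) with q in F, |t| <= a *)
Definition cantor_band (n : nat) (F : set 'rV[R]_n) (a : R) : set 'rV[R]_(1 + n) :=
  [set p | exists q t, F q /\ `|t| <= a /\
                      p = row_mx (\row_(j < 1) sin t) (cos t *: q)].

End Defs.

(* Main.v *)
(* The hypersurface is [{L = 1/2}] for a function [L] that is positive and homogeneous of
   degree 2 on the punctured space, parametrized radially by [x p = p / sqrt (2 L p)], with
   Gauss map [grad L / |grad L|]. The second fundamental form is then a positive multiple of
   the Hessian of [L] restricted to [(grad L)^perp], so that it suffices that this Hessian is
   positive definite off the band and has kernel spanned by the axis on the band.

   Writing a point as [(s, z)], with [r = |z|], we take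
     [L = r^2 / 2 + s^2 psi (r^2 / s^2) + eps s^2 theta (s^2 / r^2) g (z / r)].
   The first term gives the cylinder, with Hessian [|dz|^2]. The second one is convex enough,
   flat exactly for [s^2 <= r^2], and closes the cylinder by two caps. In the third one [theta]
   is a cutoff near the poles and [g = sum_i 2^-i exp (-1 / (<c_i, .> - cos r_i)_+)], summed
   over the holes of [F], is smooth and vanishes on the sphere exactly on [F]. Over the holes
   its contribution [2 eps g ds^2] is positive; the mixed terms are controlled because
   [|grad g|^2] is bounded by a multiple of [g], and all the others are absorbed by [|dz|^2]
   when [eps] is small. *)

Require Import Defs.
From HB Require Import structures.
From mathcomp Require Import all_boot all_order all_algebra.
From mathcomp Require Import all_classical all_reals all_analysis.
From mathcomp Require Import ring lra.
Import Order.TTheory GRing.Theory Num.Theory.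
Local Open Scope classical_set_scope.
Local Open Scope ring_scope.

Set Implicit Arguments.
Unset Strict Implicit.
Unset Printing Implicit Defensive.
Import numFieldNormedType.Exports.

(** * Smooth real functions on an open set of a normed module *)

(** Degree 2 is chosen because Euler's relation then reads [Hess L (p, v) = dL v] at [p]: radial
    vectors pair to zero with every vector tangent to the level set, so the ambient Hessian carries
    the whole second fundamental form.

    The obstacle is the mixed term [4 s ds dg]. It is linear in [dg], while the positivity available
    over a hole, [2 g ds^2], is linear in [g], and both degenerate near [F], where infinitely many
    ever smaller holes accumulate. The bound of [|dg|^2] by a multiple of [g] is therefore proved
    for each summand, with a constant that depends neither on the hole nor on the point.

    The constant [delta0 = 1] is below [pi / 2], so all [cos r_i] are nonnegative and [g] vanishes
    at the value [0] that the direction [z / r] takes on the axis. The set [F] cannot be empty,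
    because the centers of infinitely many disjoint holes accumulate somewhere; hence the rank does
    drop to [n - 1]. The half-width of the band is [pi / 4], the angle at which [s^2 = r^2]. *)

Lemma scaleRE (R : pzRingType) (a b : R^o) : a *: b = a * b.
Proof. by []. Qed.

Section Smooth.
Context {R : realType} {V : normedModType R}.
Implicit Types (U : set V) (f g : V -> R) (y u v w : V).

(* Differentiable [k] times, in the sense of iterated directional derivatives; continuity
   is implied, so [Ck U 0] carries no information. *)
Fixpoint Ck U k f : Prop :=
  if k is k'.+1 then
    (forall y, U y -> differentiable f y) /\ forall v, Ck U k' ('D_v f)
  else True.

Definition smooth U f := forall k, Ck U k f.

Lemma Ck_le U k f : Ck U k.+1 f -> Ck U k f.
Proof.
elim: k f => [//|k IH] f [df Df]; split => // v; exact: IH.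
Qed.

(** Every clause of [Ck] is a statement at a single point, since ['D_v f] does not refer to [U].
    This is what allows smoothness to be checked on different open sets with different formulas,
    away from junk values of division. *)
Lemma Ck_local U k f : (forall y, U y -> exists W, W y /\ Ck W k f) -> Ck U k f.
Proof.
elim: k f => [//|k IH] f H; split=> [y /H[W [Wy [dW _]]]|v]; first exact: dW.
by apply: IH => y /H[W [Wy [_ CW]]]; exists W; split => //; exact: CW.
Qed.

Lemma derive_eq_in U f g v y : open U -> {in U, f =1 g} -> U y ->
  'D_v f y = 'D_v g y.
Proof.
move=> oU fg Uy; apply: near_eq_derive.
by apply: filterS (open_nbhs_nbhs (conj oU Uy)) => z Uz; apply: fg; rewrite inE.
Qed.

(** Differentiability from an explicit remainder estimate, for the places where the rules of
    calculus give nothing: [flat] at the origin and the infinite sums. *)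
Lemma is_diff_littleo f y (l : {linear V -> R}) : continuous l ->
  (forall e, 0 < e -> \forall h \near 0, `|f (h + y) - f y - l h| <= e * `|h|) ->
  differentiable f y /\ 'd f y = l :> (V -> R).
Proof.
move=> cl H.
have E : f \o shift y = cst (f y) + l +o_ 0 id.
  apply/eqaddoP => e e0; apply: filterS (H e e0) => h.
  by rewrite /= !fctE opprD addrA.
have dE := diff_unique cl E.
by split => //; apply/diff_locallyP; rewrite dE.
Qed.

Lemma differentiable_eq_in U f g y : open U -> {in U, f =1 g} -> U y ->
  differentiable f y -> differentiable g y.
Proof.
move=> oU fg Uy df.
apply: (is_diff_littleo (diff_continuous df) _).1 => e e0.
have /diff_locallyP[_ /eqaddoP/(_ e e0)] := df.
have /nbhs0P nU := open_nbhs_nbhs (conj oU Uy).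
apply: filterS2 nU => h Uh.
rewrite -!fg ?inE// ?[h + _]addrC// => H; apply: le_trans H.
by rewrite le_eqVlt; apply/orP; left; apply/eqP; congr `| _ |; rewrite !fctE /= opprD addrA addrC.
Qed.

Lemma Ck_eq_in U k f g : open U -> {in U, f =1 g} -> Ck U k f -> Ck U k g.
Proof.
move=> oU; elim: k f g => [//|k IH] f g fg [df Df]; split=> [y Uy|v].
  exact: (differentiable_eq_in oU fg Uy (df _ Uy)).
apply: IH (Df v) => y; rewrite inE => Uy; exact: (derive_eq_in _ oU fg Uy).
Qed.

Lemma smooth_eq_in U f g : open U -> {in U, f =1 g} -> smooth U f -> smooth U g.
Proof. by move=> oU fg sf k; apply: Ck_eq_in (sf k). Qed.

Lemma smooth_local U f : (forall y, U y -> exists W, W y /\ smooth W f) -> smooth U f.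
Proof. by move=> H k; apply: Ck_local => y /H[W [Wy sW]]; exists W; split. Qed.

Lemma smooth_diff U f y : smooth U f -> U y -> differentiable f y.
Proof. by move=> /(_ 1%N)[df _]; exact: df. Qed.

Lemma smooth_derivable U f y v : smooth U f -> U y -> derivable f y v.
Proof. by move=> sf Uy; apply/diff_derivable/(smooth_diff sf). Qed.

Lemma smooth_derive U f v : smooth U f -> smooth U ('D_v f).
Proof. by move=> sf k; have [_] := sf k.+1; exact. Qed.

Lemma Ck_cst U k (c : R) : Ck U k (fun=> c).
Proof.
elim: k c => [//|k IH] c; split=> [y Uy|v]; first exact: differentiable_cst.
by rewrite (_ : 'D_v _ = fun=> 0)//; apply/funext => y; rewrite derive_cst.
Qed.

Lemma smooth_cst U (c : R) : smooth U (fun=> c).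
Proof. by move=> k; exact: Ck_cst. Qed.

Lemma Ck_add U k f g : open U -> Ck U k f -> Ck U k g -> Ck U k (fun y => f y + g y).
Proof.
move=> oU; elim: k f g => [//|k IH] f g [df Df] [dg Dg]; split=> [y Uy|v].
  exact: differentiableD (df _ Uy) (dg _ Uy).
apply: (Ck_eq_in oU _ (IH _ _ (Df v) (Dg v))) => y; rewrite inE => Uy.
by rewrite [RHS](@deriveD _ _ _ f g y v)//; apply/diff_derivable; [exact: df|exact: dg].
Qed.

Lemma Ck_mul U k f g : open U -> Ck U k f -> Ck U k g -> Ck U k (fun y => f y * g y).
Proof.
move=> oU; elim: k f g => [//|k IH] f g Cf Cg; have [[df Df] [dg Dg]] := (Cf, Cg).
split=> [y Uy|v]; first exact: differentiableM (df _ Uy) (dg _ Uy).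
apply: (Ck_eq_in oU _ (Ck_add oU (IH _ _ (Ck_le Cf) (Dg v)) (IH _ _ (Ck_le Cg) (Df v)))).
move=> y; rewrite inE => Uy.
by rewrite [RHS](@deriveM _ _ f g y v)//; apply/diff_derivable; [exact: df|exact: dg].
Qed.

Lemma smooth_add U f g : open U -> smooth U f -> smooth U g ->
  smooth U (fun y => f y + g y).
Proof. by move=> oU sf sg k; apply: Ck_add. Qed.

Lemma smooth_mul U f g : open U -> smooth U f -> smooth U g ->
  smooth U (fun y => f y * g y).
Proof. by move=> oU sf sg k; apply: Ck_mul. Qed.

Lemma smooth_opp U f : open U -> smooth U f -> smooth U (fun y => - f y).
Proof.
move=> oU sf; rewrite (_ : (fun y => _) = fun y => -1 * f y).
  by apply: smooth_mul => //; exact: smooth_cst.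
by apply/funext => y; rewrite mulN1r.
Qed.

Lemma smooth_sub_fun U f g : open U -> smooth U f -> smooth U g ->
  smooth U (fun y => f y - g y).
Proof. by move=> oU sf sg; apply: smooth_add => //; exact: smooth_opp. Qed.

Lemma smooth_exp U f k : open U -> smooth U f -> smooth U (fun y => f y ^+ k).
Proof.
move=> oU sf; elim: k => [|k IH]; first exact: smooth_cst.
by rewrite (_ : (fun y => _) = fun y => f y * f y ^+ k);
  [exact: smooth_mul|apply/funext => y; rewrite exprS].
Qed.

Lemma Ck_sum U k (I : Type) (r : seq I) (F : I -> V -> R) : open U ->
  (forall i, Ck U k (F i)) -> Ck U k (fun y => \sum_(i <- r) F i y).
Proof.
move=> oU sF; elim: r => [|i r IH].
  by rewrite (_ : (fun y => _) = fun=> 0);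
    [exact: Ck_cst|apply/funext => y; rewrite big_nil].
by rewrite (_ : (fun y => _) = fun y => F i y + \sum_(i <- r) F i y);
  [exact: Ck_add|apply/funext => y; rewrite big_cons].
Qed.

Lemma smooth_sum U (I : Type) (r : seq I) (F : I -> V -> R) : open U ->
  (forall i, smooth U (F i)) -> smooth U (fun y => \sum_(i <- r) F i y).
Proof. by move=> oU sF k; apply: Ck_sum => // i; exact: sF. Qed.

(** The derivative [- (1/f)^2 * 'D_v f] only involves functions already known to be [Ck U k], so the
    induction closes; square roots and flat functions follow the same pattern. *)
Lemma Ck_inv U k f : open U -> (forall y, U y -> f y != 0) -> Ck U k f ->
  Ck U k (fun y => (f y)^-1).
Proof.
move=> oU f0; elim: k => [//|k IH] Cf; have [df Df] := Cf; split=> [y Uy|v].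
  by apply: differentiable_comp (df _ Uy) _; exact/differentiable_Rinv/f0.
have Ci := IH (Ck_le Cf).
apply: (Ck_eq_in oU _ (Ck_mul oU (Ck_mul oU (Ck_cst U k (-1)) (Ck_mul oU Ci Ci)) (Df v))).
move=> y; rewrite inE => Uy.
rewrite deriveV ?f0//; last exact/diff_derivable/df.
by rewrite /= -invfM -expr2 mulN1r.
Qed.

Lemma smooth_inv U f : open U -> (forall y, U y -> f y != 0) -> smooth U f ->
  smooth U (fun y => (f y)^-1).
Proof. by move=> oU f0 sf k; exact: Ck_inv. Qed.

Lemma derive_comp_real (phi : R -> R) f y v d : differentiable f y ->
  is_derive (f y) 1 phi d -> 'D_v (fun z => phi (f z)) y = d * 'D_v f y.
Proof.
move=> df [/derivable1_diffP dphi phiE].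
have E := @deriveE _ _ _ (phi \o f) y v (differentiable_comp df dphi).
rewrite diff_comp// in E; rewrite -phiE (deriveE _ dphi) (deriveE _ df) mulrC.
apply: etrans E _; rewrite /=.
by rewrite -[X in 'd _ _ X = _]mulr1 [LHS]linearZ.
Qed.

Lemma differentiable_comp_real (phi : R -> R) f y d : differentiable f y ->
  is_derive (f y) 1 phi d -> differentiable (fun z => phi (f z)) y.
Proof.
by move=> df [/derivable1_diffP dphi _]; exact: (differentiable_comp df dphi).
Qed.

Lemma Ck_sqrt U k f : open U -> (forall y, U y -> 0 < f y) -> Ck U k f ->
  Ck U k (fun y => Num.sqrt (f y)).
Proof.
move=> oU f0; elim: k => [//|k IH] Cf; have [df Df] := Cf; split=> [y Uy|v].
  exact: differentiable_comp_real (df _ Uy) (is_derive1_sqrt (f0 _ Uy)).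
have Ci := IH (Ck_le Cf).
have C2 : Ck U k (fun y => (2 * Num.sqrt (f y))^-1).
  apply: Ck_inv => //; last by apply: Ck_mul => //; exact: Ck_cst.
  by move=> y Uy; rewrite mulf_neq0// gt_eqF// sqrtr_gt0 f0.
apply: (Ck_eq_in oU _ (Ck_mul oU C2 (Df v))) => y; rewrite inE => Uy.
by rewrite (derive_comp_real _ (df _ Uy) (is_derive1_sqrt (f0 _ Uy))).
Qed.

Lemma smooth_sqrt U f : open U -> (forall y, U y -> 0 < f y) -> smooth U f ->
  smooth U (fun y => Num.sqrt (f y)).
Proof. by move=> oU f0 sf k; exact: Ck_sqrt. Qed.

Lemma derive_linear f y v : (forall k u w, f (k *: u + w) = k * f u + f w) ->
  'D_v f y = f v.
Proof.
move=> lf; apply/lim_near_cst => //; near=> h; rewrite /= lf addrK.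
by rewrite scaleRE mulKf//; near: h; exact: nbhs_dnbhs_neq.
Unshelve. all: by end_near. Qed.

Lemma smooth_linear U f : (forall y, differentiable f y) ->
  (forall k u w, f (k *: u + w) = k * f u + f w) -> smooth U f.
Proof.
move=> df lf [//|k]; split=> [y _|v]; first exact: df.
by rewrite (_ : 'D_v f = fun=> f v); [exact: Ck_cst|apply/funext => y; exact: derive_linear].
Qed.

Lemma deriveDv f y u v : differentiable f y -> 'D_(u + v) f y = 'D_u f y + 'D_v f y.
Proof. by move=> df; rewrite !deriveE// linearD. Qed.

Lemma deriveZv f y (c : R) v : differentiable f y -> 'D_(c *: v) f y = c * 'D_v f y.
Proof. by move=> df; rewrite !deriveE// linearZ. Qed.

Lemma derive2_mul U f g u v y : open U -> smooth U f -> smooth U g -> U y ->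
  'D_u ('D_v (fun z => f z * g z)) y =
  f y * 'D_u ('D_v g) y + 'D_u f y * 'D_v g y + 'D_v f y * 'D_u g y
  + g y * 'D_u ('D_v f) y.
Proof.
move=> oU sf sg Uy.
have dd h w z : smooth U h -> U z -> derivable h z w by exact: smooth_derivable.
have E : {in U, 'D_v (fun z => f z * g z) =1 (f * 'D_v g) + (g * 'D_v f)}.
  by move=> z; rewrite inE => Uz; rewrite [LHS](@deriveM _ _ f g)//; exact: dd.
have [sDf sDg] := (smooth_derive v sf, smooth_derive v sg).
rewrite (derive_eq_in _ oU E Uy) deriveD ?deriveM//; try exact: dd;
  try by apply: derivableM; exact: dd.
move: ('D_u ('D_v g) y) ('D_u ('D_v f) y) ('D_u f y) ('D_u g y) ('D_v f y) ('D_v g y).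
by move=> a b c d e h; rewrite !scaleRE; ring.
Qed.

Lemma derive2_comp (phi phi' phi'' : R -> R) U f u v y : open U -> smooth U f -> U y ->
  (forall z, U z -> is_derive (f z) 1 phi (phi' (f z))) ->
  is_derive (f y) 1 phi' (phi'' (f y)) ->
  'D_u ('D_v (fun z => phi (f z))) y =
  phi'' (f y) * 'D_u f y * 'D_v f y + phi' (f y) * 'D_u ('D_v f) y.
Proof.
move=> oU sf Uy p1 p2.
have df z : U z -> differentiable f z by exact: smooth_diff.
have E : {in U, 'D_v (fun z => phi (f z)) =1 (fun z => phi' (f z)) * 'D_v f}.
  by move=> z; rewrite inE => Uz; rewrite (derive_comp_real _ (df _ Uz) (p1 _ Uz)).
rewrite (derive_eq_in _ oU E Uy) deriveM.
- rewrite (derive_comp_real _ (df _ Uy) p2).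
  move: ('D_u ('D_v f) y) ('D_u f y) ('D_v f y) (phi'' _) (phi' _) => a b c d e.
  by rewrite !scaleRE; ring.
- exact/diff_derivable/(differentiable_comp_real (df _ Uy) p2).
- exact: smooth_derivable (smooth_derive v sf) Uy.
Qed.

End Smooth.

(** * Flat functions and weighted sums of them *)

Section FlatFunction.
Context {R : realType}.
Implicit Types (P : {poly R}) (x u : R).

Lemma exprM_expRN_le k u : 0 <= u -> u ^+ k * expR (- u) <= k`!%:R.
Proof.
move=> u0; rewrite expRN ler_pdivrMr ?expR_gt0//.
case: k => [|k]; first by rewrite expr0 mul1r -expR0 ler_expR.
have k0 : 0 < k.+1`!%:R :> R by rewrite ltr0n fact_gt0.
rewrite mulrC -ler_pdivrMr//; apply: le_trans (expR_ge1Dxn k u0).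
by rewrite lerDr.
Qed.

Lemma horner_expRN_bounded P :
  exists M, forall u, 0 <= u -> `|P.[u]| * expR (- u) <= M.
Proof.
(* The extra power of [u] absorbs the factor ['X] in the induction on the polynomial. *)
suff /(_ 0%N)[M H] : forall k, exists M, forall u, 0 <= u ->
    `|P.[u]| * u ^+ k * expR (- u) <= M.
  by exists M => u u0; have := H u u0; rewrite mulr1.
elim/poly_ind: P => [k|P c IH k].
  by exists 0 => u u0; rewrite horner0 normr0 !mul0r.
have [M H] := IH k.+1; exists (M + `|c| * k`!%:R) => u u0.
rewrite hornerMXaddC -mulrA (le_trans (ler_wpM2r _ (ler_normD _ _)))//.
  by rewrite mulr_ge0 ?exprn_ge0// expR_ge0.
rewrite mulrDl lerD//; last by rewrite ler_wpM2l// exprM_expRN_le.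
by have := H u u0; rewrite normrM (ger0_norm u0) exprS !mulrA.
Qed.

(* The flat functions [P(1/x) exp(-1/x)], extended by [0] to [x <= 0]: a family of bounded
   functions closed under differentiation. *)
Definition flat P x : R := if 0 < x then P.[x^-1] * expR (- x^-1) else 0.

(** With [u = 1/x] one has [du/dx = - u^2], so the derivative of [P(u) exp (-u)] in [x] is
    [u^2 (P - P')(u) exp (-u)]. *)
Definition flatD P : {poly R} := 'X^2 * (P - P^`()).

Lemma flat_le0 P x : x <= 0 -> flat P x = 0.
Proof. by rewrite /flat; case: ltP. Qed.

Lemma flat_bounded P : exists M, forall x, `|flat P x| <= M.
Proof.
have [M H] := horner_expRN_bounded P.
have M0 : 0 <= M by apply: le_trans (H 0 (lexx 0)); rewrite mulr_ge0 ?expR_ge0.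
exists M => x; rewrite /flat; case: ltP => x0; last by rewrite normr0.
by rewrite normrM (ger0_norm (expR_ge0 _)) H// invr_ge0 ltW.
Qed.

(** For [x > 0] the flat function of ['X^2 * P] is [flat P x / x^2], and it is bounded. Quadratic
    decay is all that differentiability at the origin requires. *)
Lemma flat_le_sqr P : exists M, forall x, `|flat P x| <= M * x ^+ 2.
Proof.
have [M H] := flat_bounded ('X^2 * P).
have M0 : 0 <= M by exact: le_trans (normr_ge0 _) (H 0).
exists M => x; move: (H x); rewrite /flat; case: ltP => x0 Hx; last first.
  by rewrite normr0 mulr_ge0 ?sqr_ge0.
rewrite -ler_pdivrMr ?exprn_gt0//; apply: le_trans Hx.
rewrite hornerM hornerXn -mulrA [in leRHS]normrM.
by rewrite [`|x^-1 ^+ 2|]ger0_norm ?sqr_ge0// exprVn mulrC.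
Qed.

Lemma is_derive_flat P x : is_derive x 1 (flat P) (flat (flatD P) x).
Proof.
have [x0|x0|->] := ltgtP x 0.
- rewrite flat_le0 ?ltW//; apply: near_eq_is_derive (is_derive_cst (0 : R) x 1).
  near=> y; rewrite flat_le0//=; apply: ltW; near: y; exact: lt_nbhsl.
- have xn0 : x != 0 by rewrite gt_eqF.
  have dV : is_derive x 1 (fun y : R => y^-1) (- x ^- 2).
    have := @is_deriveV _ id x 1 1 xn0 _.
    by rewrite [_ *: _]mulr1; apply; exact: is_derive_id.
  have d1 : is_derive x 1 (fun y : R => P.[y^-1]) (P^`().[x^-1] * (- x ^- 2)).
    have := @is_derive1_comp _ (horner P) (fun y : R => y^-1) x _ _ (is_derive_poly P x^-1) dV.
    by [].
  have dN : is_derive x 1 (fun y : R => - y^-1) (x ^- 2).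
    by have := is_deriveN dV; rewrite opprK.
  have d2 : is_derive x 1 (fun y : R => expR (- y^-1)) (expR (- x^-1) * x ^- 2).
    exact: (@is_derive1_comp _ expR (fun y : R => - y^-1) x _ _ (is_derive_expR _) dN).
  apply: near_eq_is_derive; last first.
    apply: is_derive_eq (is_deriveM d1 d2) _; rewrite /flat x0.
    by rewrite /flatD hornerM hornerXn hornerD hornerN exprVn !scaleRE; ring.
  by near=> y; rewrite /flat ifT//; near: y; exact: lt_nbhsr.
- rewrite flat_le0//; have [M H] := flat_le_sqr P.
  have M0 : 0 <= M by have := H 1; rewrite expr1n mulr1; exact: le_trans.
  have [|d dE] := @is_diff_littleo _ _ (flat P) 0 (\0 : {linear R -> R})
      (fun x => cvg_cst (0 : R)) _.
  + move=> e e0; have Me : 0 < e / (M + 1) by rewrite divr_gt0// ltr_wpDl.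
    near=> h; rewrite addr0 (flat_le0 _ (lexx 0)) !subr0.
    apply: le_trans (H h) _; rewrite -(ger0_norm (sqr_ge0 h)) normrX expr2 mulrA.
    rewrite ler_wpM2r//; apply: (@le_trans _ _ ((M + 1) * `|h|)).
      by rewrite ler_wpM2r// lerDl.
    rewrite mulrC -ler_pdivlMr; last by rewrite ltr_wpDl.
    near: h; exact: (@nbhs0_le R R _ Me).
  + apply: DeriveDef; first exact: diff_derivable.
    by rewrite deriveE// dE.
Unshelve. all: by end_near. Qed.

End FlatFunction.

(** * A second-order Taylor bound *)

Section Taylor.
Context {R : realType}.

Lemma mvt_all (f f' : R -> R) (a b : R) : (forall x, is_derive (x : R) 1 f (f' x)) ->
  exists c, f b - f a = f' c * (b - a) /\ `|c - a| <= `|b - a|.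
Proof.
move=> df.
have cf x : {for x, continuous f}.
  by apply/differentiable_continuous/derivable1_diffP; have [] := df x.
have M x y : x <= y -> exists2 c, c \in `[x, y]%R & f y - f x = f' c * (y - x).
  move=> xy; apply: (MVT_segment xy (fun z _ => df z)).
  by apply: continuous_in_subspaceT => z _; exact: cf.
have [ab|/ltW ba] := leP a b.
  have [c /itvP cab E] := M _ _ ab; exists c; split=> //.
  by rewrite !ger0_norm ?subr_ge0 ?cab// lerB ?cab.
have [c /itvP cab E] := M _ _ ba; exists c.
split; first by rewrite -opprB E -mulrN opprB.
by rewrite !ler0_norm ?subr_le0 ?cab// lerN2 lerB ?cab.
Qed.

(** Two applications of the mean value theorem, the second between [a] and the intermediate point of
    the first; hence [M] in place of the sharp [M / 2]. *)
Lemma taylor2_bound (f f' f'' : R -> R) (M a b : R) :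
  (forall x : R, is_derive x 1 f (f' x)) -> (forall x : R, is_derive x 1 f' (f'' x)) ->
  (forall x, `|f'' x| <= M) ->
  `|f b - f a - f' a * (b - a)| <= M * `|b - a| ^+ 2.
Proof.
move=> df ddf HM; have [c [-> ca]] := mvt_all a b df.
have [d [E _]] := mvt_all a c ddf.
rewrite -mulrBl E !normrM expr2 mulrA ler_wpM2r// ler_pM//.
Qed.

End Taylor.

(** * Series dominated by a geometric one *)

Section Tsum.
Context {R : realType}.
Implicit Types (u v : nat -> R) (A k : R).

(** This form of summability is stable under multiplication by bounded sequences, which is all that
    differentiation does to the terms of the sums below. *)
Definition geo_le A u := forall i, `|u i| <= A * 2^-1 ^+ i.

Definition tsum u : R := limn (series u).

Lemma geo_le_cvg A u : geo_le A u -> cvgn (series u).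
Proof.
move=> H; apply: normed_cvg; rewrite /normed_series_of.
apply: (@series_le_cvg _ _ (geometric A 2^-1)) => //=.
- by move=> i; exact: le_trans (H i).
- by apply: is_cvg_geometric_series; rewrite ger0_norm// invf_lt1// ltr1n.
Qed.

Lemma tsum_le u v A B : geo_le A u -> geo_le B v -> (forall i, u i <= v i) ->
  tsum u <= tsum v.
Proof. by move=> /geo_le_cvg cu /geo_le_cvg cv; exact: lim_series_le. Qed.

Lemma tsum_geo A : tsum (fun i => A * 2^-1 ^+ i) = A * 2.
Proof.
have h : `|2^-1 : R| < 1 by rewrite ger0_norm// invf_lt1// ltr1n.
rewrite /tsum; have /cvg_lim -> // := @cvg_geometric_series _ A _ h.
by congr (_ * _); field.
Qed.

Lemma geo_leD A B u v : geo_le A u -> geo_le B v -> geo_le (A + B) (fun i => u i + v i).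
Proof.
by move=> Hu Hv i; rewrite mulrDl (le_trans (ler_normD _ _))// lerD.
Qed.

Lemma geo_leM A B u v : geo_le A u -> (forall i, `|v i| <= B) ->
  geo_le (A * B) (fun i => u i * v i).
Proof. by move=> Hu Hv i; rewrite normrM mulrAC ler_pM. Qed.

Lemma geo_leZ A k u : geo_le A u -> geo_le (A * `|k|) (fun i => k * u i).
Proof. by move=> Hu i; rewrite normrM mulrC mulrAC ler_wpM2r. Qed.

Lemma tsumD A B u v : geo_le A u -> geo_le B v ->
  tsum (fun i => u i + v i) = tsum u + tsum v.
Proof.
move=> /geo_le_cvg cu /geo_le_cvg cv.
by rewrite /tsum -[X in series X]/(u + v) lim_seriesD.
Qed.

Lemma tsumZ A k u : geo_le A u -> tsum (fun i => k * u i) = k * tsum u.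
Proof.
move=> /geo_le_cvg cu.
by rewrite /tsum -[X in series X]/(k *: (u : R^o ^nat)) lim_seriesZ.
Qed.

Lemma geo_le0 A : 0 <= A -> geo_le A (fun=> 0).
Proof. by move=> A0 i; rewrite normr0 mulr_ge0// exprn_ge0. Qed.

Lemma tsum0 : tsum (fun=> 0) = 0.
Proof.
by have := tsumZ 0 (geo_le0 (lexx 0)); rewrite !mul0r.
Qed.

Lemma geo_le_sum m (F : 'I_m -> nat -> R) (A : 'I_m -> R) :
  (forall j, geo_le (A j) (F j)) -> geo_le (\sum_j A j) (fun i => \sum_j F j i).
Proof.
move=> H i; rewrite mulr_suml (le_trans (ler_norm_sum _ _ _))// ler_sum// => j _.
exact: H.
Qed.

Lemma tsum_sum m (F : 'I_m -> nat -> R) (A : 'I_m -> R) :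
  (forall j, geo_le (A j) (F j)) ->
  tsum (fun i => \sum_j F j i) = \sum_j tsum (F j).
Proof.
elim: m F A => [|m IH] F A H.
  by rewrite big_ord0 -[RHS]tsum0; congr tsum; apply/funext => i; rewrite big_ord0.
rewrite big_ord_recl -(IH _ (fun j => A (lift ord0 j))); last by move=> j; exact: H.
rewrite -(tsumD (H ord0) (@geo_le_sum _ _ (fun j => A (lift ord0 j)) _))//.
by congr tsum; apply/funext => i; rewrite big_ord_recl.
Qed.

Lemma tsum_norm_le A u : geo_le A u -> `|tsum u| <= A * 2.
Proof.
move=> H; have A0 : 0 <= A.
  by have := H 0%N; rewrite expr0 mulr1; exact: le_trans.
have HA : geo_le A (fun i => A * 2^-1 ^+ i).
  by move=> i; rewrite ger0_norm ?lexx// mulr_ge0// exprn_ge0.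
rewrite -tsum_geo ler_norml -mulN1r -(tsumZ _ HA).
have HN : geo_le A (fun i => -1 * (A * 2^-1 ^+ i)).
  by move=> i; rewrite normrM normrN1 mul1r; exact: HA.
by rewrite (tsum_le HN H) ?(tsum_le H HA)// => i;
  have := H i; rewrite ler_norml ?mulN1r => /andP[].
Qed.

Lemma le_tsum A u i : geo_le A u -> (forall j, 0 <= u j) -> u i <= tsum u.
Proof.
move=> H u0; have cu := geo_le_cvg H.
apply: le_trans (nondecreasing_cvgn_le (nondecreasing_series _) cu i.+1).
  by rewrite /series /= big_nat_recr//= lerDr sumr_ge0.
by move=> j _ _; exact: u0.
Qed.

Lemma tsum_ge0 A u : geo_le A u -> (forall j, 0 <= u j) -> 0 <= tsum u.
Proof. by move=> H u0; apply: le_trans (le_tsum 0 H u0). Qed.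

End Tsum.

(** * The Euclidean dot product *)

Section Dot.
Context {R : realType} {m : nat}.
Implicit Types (u v w : 'rV[R]_m) (k : R).

Lemma dotC u v : dot u v = dot v u.
Proof. by apply: eq_bigr => i _; rewrite mulrC. Qed.

Lemma dotDr u v w : dot u (v + w) = dot u v + dot u w.
Proof. by rewrite /dot -big_split; apply: eq_bigr => i _; rewrite !mxE mulrDr. Qed.

Lemma dotZr k u v : dot u (k *: v) = k * dot u v.
Proof. by rewrite /dot mulr_sumr; apply: eq_bigr => i _; rewrite !mxE mulrCA. Qed.

Lemma dotDl u v w : dot (u + v) w = dot u w + dot v w.
Proof. by rewrite dotC dotDr !(dotC w). Qed.

Lemma dotZl k u v : dot (k *: u) v = k * dot u v.
Proof. by rewrite dotC dotZr dotC. Qed.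

Lemma dotNr u v : dot u (- v) = - dot u v.
Proof. by rewrite -scaleN1r dotZr mulN1r. Qed.

Lemma dotBr u v w : dot u (v - w) = dot u v - dot u w.
Proof. by rewrite dotDr dotNr. Qed.

Lemma dotBl u v w : dot (u - v) w = dot u w - dot v w.
Proof. by rewrite dotC dotBr !(dotC w). Qed.

Lemma dot0r u : dot u 0 = 0.
Proof. by rewrite -(scale0r 0) dotZr mul0r. Qed.

Lemma dot0l u : dot 0 u = 0.
Proof. by rewrite dotC dot0r. Qed.

Lemma dotuu_ge0 u : 0 <= dot u u.
Proof. by apply: sumr_ge0 => i _; rewrite -expr2 sqr_ge0. Qed.

Lemma dotuu_eq0 u : (dot u u == 0) = (u == 0).
Proof.
apply/eqP/eqP => [|->]; last exact: dot0r.
move/psumr_eq0P => H; apply/rowP => i; rewrite mxE; apply/eqP.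
by rewrite -sqrf_eq0 expr2 H// => j _; rewrite -expr2 sqr_ge0.
Qed.

Lemma dotuu_gt0 u : (0 < dot u u) = (u != 0).
Proof. by rewrite lt_def dotuu_ge0 andbT dotuu_eq0. Qed.

Lemma dot_CS u v : dot u v ^+ 2 <= dot u u * dot v v.
Proof.
have [->|v0] := eqVneq v 0; first by rewrite !dot0r mulr0 expr0n.
have vv : 0 < dot v v by rewrite dotuu_gt0.
have := dotuu_ge0 (dot v v *: u - dot u v *: v).
rewrite !dotBl !dotBr !dotZl !dotZr (dotC v u) -(pmulr_rge0 _ vv).
move: (dot u u) (dot u v) (dot v v) vv => a b c c0.
move=> H; have : 0 <= c * (c * (a * c - b ^+ 2)) by lra.
by rewrite !pmulr_rge0// subr_ge0.
Qed.

Lemma dot_unit_le c u : dot c c = 1 -> dot c u ^+ 2 <= dot u u.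
Proof. by move=> c1; have := dot_CS c u; rewrite c1 mul1r. Qed.

Lemma coord_dot u j : dot u (delta_mx 0 j) = u 0 j.
Proof.
rewrite /dot (bigD1 j)//= mxE !eqxx mulr1 big1 ?addr0// => i ij.
by rewrite mxE (negPf ij) andbF mulr0.
Qed.

Lemma row_norm_coord u j : `|u 0 j| <= `|u|.
Proof. by rewrite [leRHS]/Num.Def.normr/= mx_normrE; exact: (le_bigmax _ _ (0, j)). Qed.

End Dot.

Lemma unit_coord_le (R : realType) m (c : 'rV[R]_m) j : dot c c = 1 -> `|c 0 j| <= 1.
Proof.
move=> c1; have := dot_unit_le (delta_mx 0 j) c1.
rewrite !coord_dot mxE !eqxx -(ler_sqrt (c 0 j ^+ 2))// sqrtr_sqr sqrtr1 //.
Qed.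

(** * Differentiation of row-valued maps, coordinate by coordinate *)

Section VectorValued.
Context {R : realType} {V : normedModType R} {m : nat}.
Implicit Types (U : set V) (q : V -> 'rV[R]_m) (f : 'rV[R]_m -> R).

Lemma differentiable_row q y : (forall j, differentiable (fun z => q z 0 j) y) ->
  differentiable q y.
Proof.
move=> dq; rewrite (_ : q = \sum_j (fun z => q z 0 j *: delta_mx 0 j)).
  by apply: differentiable_sum => j; exact: (differentiableZl _ (dq j)).
by apply/funext => z; rewrite fct_sumE [LHS]row_sum_delta.
Qed.

Lemma derivable_row q y v : (forall j, derivable (fun z => q z 0 j) y v) ->
  derivable q y v.
Proof. by move=> dq; apply/derivable_mxP => i j; rewrite (ord1 i). Qed.

Lemma derive_row q y v j : (forall j, derivable (fun z => q z 0 j) y v) ->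
  'D_v q y 0 j = 'D_v (fun z => q z 0 j) y.
Proof. by move=> /derivable_row/derive_mx ->; rewrite mxE. Qed.

Lemma derive_coord f z v : differentiable f z ->
  'D_v f z = \sum_j v 0 j * 'D_(delta_mx 0 j) f z.
Proof.
move=> df; rewrite deriveE// {1}[v]row_sum_delta linear_sum.
by apply: eq_bigr => j _; rewrite linearZ /= -deriveE.
Qed.

Lemma derive_comp_row f q y v : differentiable f (q y) ->
  (forall j, differentiable (fun z => q z 0 j) y) ->
  'D_v (f \o q) y = \sum_j 'D_v (fun z => q z 0 j) y * 'D_(delta_mx 0 j) f (q y).
Proof.
move=> df dq; have dqy := differentiable_row dq.
rewrite deriveE; last exact: differentiable_comp.
rewrite diff_comp//= -deriveE// -deriveE// derive_coord//.
by apply: eq_bigr => j _; rewrite derive_row// => i; exact: diff_derivable.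
Qed.

Lemma Ck_comp_row U k f q : open U -> smooth setT f ->
  (forall j, smooth U (fun y => q y 0 j)) -> Ck U k (f \o q).
Proof.
move=> oU; elim: k f => [//|k IH] f sf sq.
have df z : differentiable f z by exact: smooth_diff sf _.
split=> [y Uy|v].
  apply: differentiable_comp => //; apply: differentiable_row => j.
  exact: smooth_diff (sq j) Uy.
have C : Ck U k (fun y =>
    \sum_j 'D_v (fun z => q z 0 j) y * 'D_(delta_mx 0 j) f (q y)).
  apply: Ck_sum => // j; apply: Ck_mul => //; first exact: (smooth_derive v (sq j)).
  exact: IH (smooth_derive _ sf) sq.
apply: Ck_eq_in C => // y; rewrite inE => Uy; rewrite derive_comp_row// => j.
exact: smooth_diff (sq j) Uy.
Qed.

Lemma smooth_comp_row U f q : open U -> smooth setT f ->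
  (forall j, smooth U (fun y => q y 0 j)) -> smooth U (fun y => f (q y)).
Proof. by move=> oU sf sq k; exact: Ck_comp_row. Qed.

End VectorValued.

(** * Weighted sums of flat functions of linear forms *)

Section FlatSum.
Context {R : realType} {n : nat} (c : nat -> 'rV[R]_n) (gam : nat -> R).
Hypothesis hc : forall i, dot (c i) (c i) = 1.
Implicit Types (a : nat -> R) (P : {poly R}) (z v : 'rV[R]_n).

(** With [a] and [P] as parameters the family is closed under differentiation: the partial
    derivative along the coordinate [j] has coefficients [a i * c i 0 j] and polynomial
    [flatD P]. *)
Definition flatsum a P z : R := tsum (fun i => a i * flat P (dot (c i) z - gam i)).

Lemma geo_le_flat A a P (b : nat -> R) : geo_le A a ->
  exists B, geo_le B (fun i => a i * flat P (b i)).
Proof. by move=> Ha; have [M HM] := flat_bounded P; exists (A * M); exact: geo_leM. Qed.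

Lemma norm_dot_unit i v : `|dot (c i) v| <= n%:R * `|v|.
Proof.
rewrite (le_trans (ler_norm_sum _ _ _))//.
rewrite (@le_trans _ _ (\sum_(i < n) `|v|))//; last by rewrite sumr_const card_ord mulr_natl.
apply: ler_sum => j _; rewrite normrM -[leRHS]mul1r ler_pM//.
  exact: unit_coord_le.
exact: row_norm_coord.
Qed.

Lemma geo_le_coord A a j : geo_le A a -> geo_le A (fun i => a i * c i 0 j).
Proof.
by move=> Ha; rewrite -[A]mulr1; apply: geo_leM => // i; exact: unit_coord_le.
Qed.

(** The remainder is bounded term by term with [taylor2_bound], uniformly in [i] because the [c i]
    are unit vectors and the second derivative of [flat P] is bounded. The derivative is given both
    as a finite sum of functions of the same family, for the induction on the order, and as one
    series, for termwise estimates. *)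
Lemma flatsum_diff A a P z : geo_le A a -> [/\ differentiable (flatsum a P) z,
  forall v, 'D_v (flatsum a P) z =
    \sum_j v 0 j * flatsum (fun i => a i * c i 0 j) (flatD P) z &
  forall v, 'D_v (flatsum a P) z =
    tsum (fun i => a i * flat (flatD P) (dot (c i) z - gam i) * dot (c i) v)].
Proof.
move=> Ha.
(* [Phi] is the candidate differential. Being linear, it is its own differential at [0], and
   ['d Phi 0] is the bundled continuous linear map that [is_diff_littleo] expects. *)
pose Phi (v : 'rV[R]_n) := \sum_j v 0 j * flatsum (fun i => a i * c i 0 j) (flatD P) z.
have dPhi w : differentiable Phi w.
  rewrite (_ : Phi = \sum_j (fun v : 'rV[R]_n =>
      v 0 j * flatsum (fun i => a i * c i 0 j) (flatD P) z)).
    apply: differentiable_sum => j.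
    exact: (differentiableM (differentiable_coord _ _ _) (differentiable_cst _ _)).
  by apply/funext => v; rewrite fct_sumE.
have PhiD v : 'd Phi 0 v = Phi v.
  rewrite -deriveE//; apply: derive_linear => k u w.
  rewrite /Phi mulr_sumr -big_split; apply: eq_bigr => j _ /=.
  by rewrite !mxE mulrDl mulrA.
have PhiE v : Phi v = tsum (fun i => a i * flat (flatD P) (dot (c i) z - gam i) * dot (c i) v).
  pose F j i := v 0 j * (a i * c i 0 j * flat (flatD P) (dot (c i) z - gam i)).
  have [M HM] := flat_bounded (flatD P).
  have HF j : geo_le (A * M * `|v 0 j|) (F j).
    by apply: geo_leZ; apply: geo_leM => //; exact: geo_le_coord.
  transitivity (tsum (fun i => \sum_j F j i)).
    rewrite (tsum_sum HF); apply: eq_bigr => j _; rewrite (@tsumZ _ (A * M))//.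
    by apply: geo_leM => //; exact: geo_le_coord.
  congr tsum; apply/funext => i; rewrite /F /dot mulr_sumr.
  by apply: eq_bigr => j _; ring.
have [M HM] := flat_bounded (flatD (flatD P)).
have A0 : 0 <= A by have := Ha 0%N; rewrite expr0 mulr1; exact: le_trans.
have M0 : 0 <= M by exact: le_trans (HM 0).
have est h : `|flatsum a P (h + z) - flatsum a P z - Phi h| <=
    A * (M * (n%:R * `|h|) ^+ 2) * 2.
  have [M1 H1] := flat_bounded P; have [M2 H2] := flat_bounded (flatD P).
  have G1 w : geo_le (A * M1) (fun i => a i * flat P (dot (c i) w - gam i)).
    exact: geo_leM.
  have G2 : geo_le (A * M2 * (n%:R * `|h|))
     (fun i => a i * flat (flatD P) (dot (c i) z - gam i) * dot (c i) h).
    by apply: geo_leM; [exact: geo_leM|move=> i; exact: norm_dot_unit].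
  have -> : flatsum a P (h + z) - flatsum a P z - Phi h = tsum (fun i =>
      (a i * flat P (dot (c i) (h + z) - gam i) + -1 * (a i * flat P (dot (c i) z - gam i)))
      + -1 * (a i * flat (flatD P) (dot (c i) z - gam i) * dot (c i) h)).
    rewrite (tsumD (geo_leD (G1 _) (geo_leZ _ (G1 _))) (geo_leZ _ G2)).
    rewrite (tsumD (G1 _) (geo_leZ _ (G1 _))) (tsumZ _ (G1 _)) (tsumZ _ G2).
    by rewrite PhiE !mulN1r.
  apply: tsum_norm_le => i.
  have := taylor2_bound (dot (c i) z - gam i) (dot (c i) (h + z) - gam i)
    (is_derive_flat P) (is_derive_flat (flatD P)) HM.
  have -> : dot (c i) (h + z) - gam i - (dot (c i) z - gam i) = dot (c i) h.
    by rewrite dotDr; ring.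
  set x := flat P _; set y := flat P _; set w := flat (flatD P) _ => H.
  have -> : a i * x + -1 * (a i * y) + -1 * (a i * w * dot (c i) h) =
    a i * (x - y - w * dot (c i) h) by ring.
  rewrite normrM mulrAC ler_pM//; apply: le_trans H _.
  by rewrite ler_wpM2l// lerXn2r ?nnegrE ?mulr_ge0// norm_dot_unit.
have [|d dE] := is_diff_littleo (diff_continuous (dPhi 0)) _ (y := z) (f := flatsum a P).
  move=> e e0; pose K := A * (M * n%:R ^+ 2) * 2 + 1.
  have K0 : 0 < K by rewrite ltr_wpDl// !mulr_ge0// exprn_ge0.
  near=> h; rewrite PhiD; apply: le_trans (est h) _.
  have -> : A * (M * (n%:R * `|h|) ^+ 2) * 2 = (K - 1) * `|h| * `|h|.
    by rewrite /K; ring.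
  rewrite ler_wpM2r//; apply: (@le_trans _ _ (K * `|h|)).
    by rewrite ler_wpM2r// gerBl.
  rewrite mulrC -ler_pdivlMr//; near: h.
  by apply: (@nbhs0_le R 'rV[R]_n); rewrite divr_gt0.
split; first exact: d.
  by move=> v; rewrite (deriveE v d) dE; exact: PhiD.
by move=> v; rewrite -PhiE (deriveE v d) dE; exact: PhiD.
Unshelve. all: by end_near. Qed.

Lemma smooth_flatsum A a P : geo_le A a -> smooth setT (flatsum a P).
Proof.
move=> Ha k; elim: k a Ha P => [//|k IH] a Ha P; split=> [z _|v].
  by have [] := flatsum_diff P z Ha.
rewrite (_ : 'D_v _ = fun z => \sum_j v 0 j * flatsum (fun i => a i * c i 0 j) (flatD P) z).
  have oT : open [set: 'rV[R]_n] by exact: openT.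
  apply: Ck_sum => // j; apply: Ck_mul => //; first exact: Ck_cst.
  exact: IH (geo_le_coord j Ha) _.
by apply/funext => z; by have [_ + _] := flatsum_diff P z Ha; exact.
Qed.

Section Composite.
Context {V : normedModType R} (U : set V) (q : V -> 'rV[R]_n).
Hypothesis oU : open U.
Hypothesis sq : forall j, smooth U (fun y => q y 0 j).
Implicit Types (y u : V).

Lemma smooth_dot_row (b : 'rV[R]_n) : smooth U (fun y => dot b (q y)).
Proof. by apply: smooth_sum => // j; apply: smooth_mul => //; exact: smooth_cst. Qed.

Lemma derive_sum_mul (F H : 'I_n -> V -> R) y u :
  (forall j, derivable (F j) y u) -> (forall j, derivable (H j) y u) ->
  'D_u (fun y => \sum_j F j y * H j y) y =
  \sum_j (F j y * 'D_u (H j) y + 'D_u (F j) y * H j y).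
Proof.
move=> dF dH; rewrite (_ : (fun y => _) = \sum_j (fun y => F j y * H j y)); last first.
  by apply/funext => z; rewrite fct_sumE.
rewrite derive_sum => [|j]; last exact: derivableM (dF j) (dH j).
apply: eq_bigr => j _; rewrite [LHS](deriveM (dF j) (dH j)) !scaleRE.
by rewrite [X in _ + X = _]mulrC.
Qed.

Lemma derive_dot_row (b : 'rV[R]_n) (r : 'I_n -> V -> R) y u :
  (forall j, derivable (r j) y u) ->
  'D_u (fun y => \sum_j b 0 j * r j y) y = \sum_j b 0 j * 'D_u (r j) y.
Proof.
move=> dr; rewrite (derive_sum_mul (fun j => derivable_cst _ _ _) dr).
by apply: eq_bigr => j _; rewrite derive_cst mul0r addr0.
Qed.

Let dq j y u : U y -> derivable (fun y => q y 0 j) y u.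
Proof. by move=> Uy; exact: smooth_derivable (sq j) Uy. Qed.

(** This finite sum of products of smooth functions can be differentiated once more; the series form
    that follows is the one to estimate. *)
Lemma derive_flatsum_row_sum A a P y u : geo_le A a -> U y ->
  'D_u (fun y => flatsum a P (q y)) y =
  \sum_j 'D_u (fun y => q y 0 j) y * flatsum (fun i => a i * c i 0 j) (flatD P) (q y).
Proof.
move=> Ha Uy; have [df dfE _] := flatsum_diff P (q y) Ha.
rewrite [LHS](derive_comp_row _ df); last by move=> j; exact: smooth_diff (sq j) Uy.
have := derive_coord (\row_j 'D_u (fun y => q y 0 j) y) df; rewrite dfE => E.
transitivity (\sum_j (\row_j 'D_u (fun y => q y 0 j) y) 0 j *
     'D_(delta_mx 0 j) (flatsum a P) (q y)).
  by apply: eq_bigr => j _; rewrite mxE.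
by rewrite -E; apply: eq_bigr => j _; rewrite mxE.
Qed.

Lemma derive_flatsum_row A a P y u : geo_le A a -> U y ->
  'D_u (fun y => flatsum a P (q y)) y =
  tsum (fun i => a i * flat (flatD P) (dot (c i) (q y) - gam i) *
                 'D_u (fun y => dot (c i) (q y)) y).
Proof.
move=> Ha Uy; rewrite (derive_flatsum_row_sum P u Ha Uy).
have [df E1 E2] := flatsum_diff P (q y) Ha.
have := E1 (\row_j 'D_u (fun y => q y 0 j) y); rewrite E2 => E.
transitivity (\sum_j (\row_j 'D_u (fun y => q y 0 j) y) 0 j *
    flatsum (fun i => a i * c i 0 j) (flatD P) (q y)).
  by apply: eq_bigr => j _; rewrite mxE.
rewrite -E; congr tsum; apply/funext => i; congr (_ * _).
rewrite derive_dot_row => [|j]; last exact: dq.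
by apply: eq_bigr => j _; rewrite mxE.
Qed.

Lemma derive_dot_bounded y u : U y ->
  exists B, forall i, `|'D_u (fun y => dot (c i) (q y)) y| <= B.
Proof.
move=> Uy; exists (n%:R * `|\row_j 'D_u (fun y => q y 0 j) y|) => i.
rewrite derive_dot_row => [|j]; last exact: dq.
apply: le_trans (norm_dot_unit i _); rewrite le_eqVlt; apply/orP; left; apply/eqP.
by congr `| _ |; apply: eq_bigr => j _; rewrite mxE.
Qed.

Lemma derive2_dot_row b y u (v : V) : U y ->
  'D_u ('D_v (fun y => dot b (q y))) y =
  \sum_j b 0 j * 'D_u ('D_v (fun y => q y 0 j)) y.
Proof.
move=> Uy; rewrite (derive_eq_in u oU _ Uy (g := fun y =>
    \sum_j b 0 j * 'D_v (fun y => q y 0 j) y)); last first.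
  by move=> z; rewrite inE => Uz; rewrite derive_dot_row// => j; exact: dq.
by rewrite derive_dot_row// => j; exact: smooth_derivable (smooth_derive v (sq j)) Uy.
Qed.

Lemma derive2_dot_bounded y u (v : V) : U y ->
  exists B, forall i, `|'D_u ('D_v (fun y => dot (c i) (q y))) y| <= B.
Proof.
move=> Uy; exists (n%:R * `|\row_j 'D_u ('D_v (fun y => q y 0 j)) y|) => i.
rewrite derive2_dot_row//.
apply: le_trans (norm_dot_unit i _); rewrite le_eqVlt; apply/orP; left; apply/eqP.
by congr `| _ |; apply: eq_bigr => j _; rewrite mxE.
Qed.

(** Obtained by differentiating the finite-sum form and exchanging the finite sum with the series.
    The Hessian becomes a single series, which can be bounded one hole at a time. *)
Lemma derive2_flatsum_row A a P y u (v : V) : geo_le A a -> U y ->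
  'D_u ('D_v (fun y => flatsum a P (q y))) y =
  tsum (fun i => a i *
    (flat (flatD (flatD P)) (dot (c i) (q y) - gam i) *
       'D_u (fun y => dot (c i) (q y)) y * 'D_v (fun y => dot (c i) (q y)) y +
     flat (flatD P) (dot (c i) (q y) - gam i) *
       'D_u ('D_v (fun y => dot (c i) (q y))) y)).
Proof.
move=> Ha Uy; rewrite (derive_eq_in u oU _ Uy (g := fun y =>
  \sum_j 'D_v (fun y => q y 0 j) y * flatsum (fun i => a i * c i 0 j) (flatD P) (q y)));
  last by move=> z; rewrite inE => Uz; exact: derive_flatsum_row_sum Ha Uz.
have sS j : smooth U (fun y => flatsum (fun i => a i * c i 0 j) (flatD P) (q y)).
  by apply: smooth_comp_row => //; exact: smooth_flatsum (geo_le_coord j Ha).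
rewrite (derive_sum_mul (H := fun j y => flatsum (fun i => a i * c i 0 j) (flatD P) (q y)))
  => [|j|j]; last 2 first.
- exact: smooth_derivable (smooth_derive v (sq j)) Uy.
- exact: smooth_derivable (sS j) Uy.
have [M1 H1] := flat_bounded (flatD P); have [M2 H2] := flat_bounded (flatD (flatD P)).
have [B HB] := derive_dot_bounded u Uy.
pose F1 j i := a i * c i 0 j * flat (flatD (flatD P)) (dot (c i) (q y) - gam i) *
  'D_u (fun y => dot (c i) (q y)) y.
pose F2 j i := a i * c i 0 j * flat (flatD P) (dot (c i) (q y) - gam i).
have G1 j : geo_le (A * M2 * B) (F1 j).
  by apply: geo_leM => //; apply: geo_leM => //; exact: geo_le_coord.
have G2 j : geo_le (A * M1) (F2 j) by apply: geo_leM => //; exact: geo_le_coord.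
pose F j i := 'D_v (fun y => q y 0 j) y * F1 j i +
  'D_u ('D_v (fun y => q y 0 j)) y * F2 j i.
have GF j := geo_leD (geo_leZ ('D_v (fun y => q y 0 j) y) (G1 j))
  (geo_leZ ('D_u ('D_v (fun y => q y 0 j)) y) (G2 j)).
transitivity (tsum (fun i => \sum_j F j i)).
  rewrite (tsum_sum GF); apply: eq_bigr => j _.
  rewrite (tsumD (geo_leZ _ (G1 j)) (geo_leZ _ (G2 j))) (tsumZ _ (G1 j)) (tsumZ _ (G2 j)).
  by rewrite (derive_flatsum_row _ _ (geo_le_coord j Ha) Uy).
congr tsum; apply/funext => i; rewrite derive2_dot_row//.
rewrite [in RHS](derive_dot_row _ (r := fun j y => q y 0 j) (u := v)) => [|j]; last exact: dq.
rewrite !mulr_sumr -big_split mulr_sumr.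
apply: eq_bigr => j _; rewrite /F /F1 /F2 /=.
move: ('D_v _ y) ('D_u ('D_v _) y) ('D_u _ y) => d1 d2 d3.
by ring.
Qed.

End Composite.

End FlatSum.

(** * Hypersurfaces as level sets of a homogeneous function *)

Section LinearAlgebra.
Context {R : realType} {m : nat}.
Implicit Types (W : 'M[R]_m) (p e u v : 'rV[R]_m).

(* the segment from [W] to the identity meets no singular matrix, except perhaps at [W] *)
Lemma det_ge0 W : (forall t v, 0 < t -> v *m W = - t *: v -> v = 0) -> 0 <= \det W.
Proof.
move=> H; rewrite leNgt; apply/negP => detW.
(* [P.[s]] is the determinant along the segment, negative at [0] and equal to [1] at [1]. A root [s]
   in between makes [- s / (1 - s)] an eigenvalue of [W]. *)
pose P : {poly R} := \det ((1 - 'X) *: map_mx polyC W + 'X%:M).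
have PE s : P.[s] = \det ((1 - s) *: W + s%:M).
  rewrite -[LHS]/(horner_eval s P) /P -det_map_mx; congr (\det _).
  apply/matrixP => i j; rewrite !mxE /=.
  by rewrite /horner_eval !hornerE hornerMn hornerX.
have P0 : P.[0] < 0 by rewrite PE subr0 scale1r raddf0 addr0.
have P1 : P.[1] = 1 by rewrite PE subrr scale0r add0r det1.
have P01 : P.[0] <= 0 <= P.[1] by rewrite P1 ler01 ltW.
have [s /andP[s0 s1] /rootP Ps] := poly_ivt ler01 P01.
move: s0 s1; rewrite !le_eqVlt => /predU1P[E|s0]; first by rewrite -E in Ps; rewrite Ps ltxx in P0.
case/predU1P => [E|s1]; first by move/eqP: Ps; rewrite E P1 oner_eq0.
move: Ps; rewrite PE => /eqP/det0P[v v0 /eqP].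
rewrite mulmxDr -scalemxAr mul_mx_scalar addr_eq0 => /eqP E.
have s10 : 0 < 1 - s by rewrite subr_gt0.
suff v00 : v = 0 by rewrite v00 eqxx in v0.
apply: (H (s / (1 - s))); first by rewrite divr_gt0.
apply: (@scalerI _ _ (1 - s)); first by rewrite gt_eqF.
by rewrite scalerA mulrN mulrCA mulfV ?gt_eqF// mulr1 scaleNr E.
Qed.

(** In the application [p] is the radial direction, killed because the normal is constant on rays,
    and [e] is the axis; with [m = n + 1] the bound [m - 2] is [n - 1]. *)
Lemma rank_ge_span W p e : (forall u, u *m W = 0 -> exists a b, u = a *: p + b *: e) ->
  (m - 2 <= \rank W)%N.
Proof.
move=> H; have : (kermx W <= col_mx p e)%MS.
  apply/rV_subP => u /sub_kermxP/H[a [b ->]]; apply/submxP.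
  by exists (row_mx a%:M b%:M); rewrite mul_row_col !mul_scalar_mx.
move/mxrankS/leq_trans => /(_ _ (rank_leq_row _)); rewrite mxrank_ker leq_subLR addnC.
by rewrite -leq_subLR.
Qed.

Lemma rank_le_span W p e : p *m W = 0 -> e *m W = 0 ->
  (forall a b, a *: p + b *: e = 0 -> a = 0 /\ b = 0) -> (\rank W <= m - 2)%N.
Proof.
move=> pW eW ind; have : (col_mx p e <= kermx W)%MS.
  by apply/sub_kermxP; rewrite mul_col_mx pW eW col_mx0.
have /eqP rf : row_free (col_mx p e).
  apply: inj_row_free => v; rewrite -[v]hsubmxK mul_row_col.
  rewrite (mx11_scalar (lsubmx v)) (mx11_scalar (rsubmx v)) !mul_scalar_mx.
  by case/ind => -> ->; rewrite !raddf0 row_mx0.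
move/mxrankS; rewrite mxrank_ker rf => H.
have r2 : (\rank W + 2 <= m)%N by rewrite -leq_subRL ?rank_leq_row.
by rewrite leq_subRL ?(leq_trans (leq_addl _ _) r2)// addnC.
Qed.

Lemma mul_invmx_eigen (X Y : 'M[R]_m) (t : R) v : X \in unitmx ->
  v *m (Y *m invmx X) = t *: v -> v *m Y = t *: (v *m X).
Proof. by move=> uX E; rewrite scalemxAl -E !mulmxA mulmxKV. Qed.

End LinearAlgebra.

(** * Maps on the sphere that are constant on rays *)

Section Gauge.
Context {R : realType} {m : nat}.
Local Notation V := 'rV[R]_m.
Implicit Types (y p u v w : V).

Definition off0 : set V := [set y | y != 0].

Lemma open_off0 : open off0.
Proof.
rewrite (_ : off0 = ~` [set 0]); last by apply/seteqP; split=> y /eqP.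
by rewrite openC; apply: accessible_closed_set1; exact: hausdorff_accessible.
Qed.

Lemma sphere_off0 p : sphere p -> off0 p.
Proof.
move=> p1; apply/negP => /eqP p0; have : dot p p = 1 by []; rewrite p0 dot0r => /eqP.
by rewrite eq_sym oner_eq0.
Qed.

Lemma rad_scale y : off0 y -> exists2 k, 0 < k & Defs.rad y = k *: y.
Proof.
by move=> y0; exists (Num.sqrt (dot y y))^-1; rewrite // invr_gt0 sqrtr_gt0 dotuu_gt0.
Qed.

Lemma smooth_coord U j : smooth U (fun y => y 0 j).
Proof.
apply: smooth_linear => [y|k u w]; first exact: differentiable_coord.
by rewrite !mxE.
Qed.

Section SphereMap.
Context {k : nat} (f : V -> 'rV[R]_k).
Hypothesis sf : forall j, smooth off0 (fun y => f y 0 j).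
Hypothesis f_rad : forall y, off0 y -> f (Defs.rad y) = f y.

(** By [f_rad] the composite with [rad] agrees with [f] off the origin, so only the coordinates of
    [f] itself have to be differentiated. *)
Lemma smooth_on_sphere_row : smooth_on_sphere f.
Proof.
have H vs : forall j, smooth off0 (fun y => Defs.iterD vs (f \o @Defs.rad R m) y 0 j).
  elim: vs => [|v vs IH] j.
    by apply: smooth_eq_in (sf j); [exact: open_off0|move=> y; rewrite inE => y0 /=; rewrite f_rad].
  apply: smooth_eq_in (smooth_derive v (IH j)); first exact: open_off0.
  move=> y; rewrite inE => y0 /=; rewrite derive_row// => i.
  exact: smooth_derivable (IH i) y0.
move=> vs; split=> [y y0|v y y0].
  apply: differentiable_continuous; apply: differentiable_row => j.
  exact: smooth_diff (H vs j) y0.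
by apply: derivable_row => j; exact: smooth_derivable (H vs j) y0.
Qed.

Lemma dsphE p v : off0 p -> dsph f p v = 'D_v f p.
Proof.
move=> p0; rewrite /dsph; apply: near_eq_derive.
apply: filterS (open_nbhs_nbhs (conj open_off0 p0)) => z z0.
by rewrite /= f_rad.
Qed.

Lemma differentiable_sphere_map p : off0 p -> differentiable f p.
Proof. by move=> p0; apply: differentiable_row => j; exact: smooth_diff (sf j) p0. Qed.

Hypothesis f_radial : forall p, off0 p -> 'D_p f p = 0.

(** Since the radial derivative vanishes, projecting the basis vectors to the tangent space does not
    change their images. The choice [z = 0] gives [dN_mx], and [z] equal to the normal gives
    [ext_dN] and [ext_dx]. *)
Lemma derive_mulmx p (z : 'rV[R]_k) u : off0 p ->
  u *m (\matrix_(i < m) (dsph f p (tproj p (ev R i)) + dot (ev R i) p *: z)) =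
  'D_u f p + dot u p *: z.
Proof.
move=> p0; have df := differentiable_sphere_map p0.
have E i : dsph f p (tproj p (ev R i)) = 'd f p (ev R i).
  rewrite dsphE// deriveE// /tproj linearB linearZ /= -(deriveE p df).
  by rewrite f_radial// scaler0 subr0.
rewrite mulmx_sum_row deriveE// {2}[u]row_sum_delta linear_sum /=.
have -> : dot u p = \sum_i u 0 i * p 0 i by [].
rewrite scaler_suml -big_split; apply: eq_bigr => i _ /=.
have -> : p 0 i = dot (ev R i) p by rewrite dotC coord_dot.
rewrite rowK E scalerDr scalerA; congr (_ + _).
by rewrite [RHS]linearZ.
Qed.

End SphereMap.

(** * Position, normal and second fundamental form of the level set *)

Variable L : V -> R.
Hypothesis sL : smooth off0 L.
Hypothesis L_gt0 : forall y, off0 y -> 0 < L y.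
Hypothesis L_hom : forall k y, 0 < k -> off0 y -> L (k *: y) = k ^+ 2 * L y.

Let oU := open_off0.

Lemma scale_off0 k y : 0 < k -> off0 y -> off0 (k *: y).
Proof. by move=> k0 y0; rewrite /off0 /= scaler_eq0 negb_or gt_eqF. Qed.

Lemma derive_hom (f : V -> R) (d : nat) k y v : smooth off0 f -> 0 < k -> off0 y ->
  (forall k y, 0 < k -> off0 y -> f (k *: y) = k ^+ d.+1 * f y) ->
  'D_v f (k *: y) = k ^+ d * 'D_v f y.
Proof.
move=> sf k0 y0 hf.
have E : {in off0, (fun z => f (k *: z)) =1 (fun z => k ^+ d.+1 * f z)}.
  by move=> z; rewrite inE => z0; exact: hf.
have dky : differentiable f (k *: y) by exact: smooth_diff sf (scale_off0 k0 y0).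
have := derive_eq_in v oU E y0.
have -> : 'D_v (fun z => f (k *: z)) y = k * 'D_v f (k *: y).
  rewrite [LHS](@deriveE _ _ _ (f \o ( *:%R k))); last exact: differentiable_comp.
  rewrite diff_comp//= (_ : 'd ( *:%R k) y v = k *: v); last by rewrite diff_val.
  by rewrite [LHS]linearZ /= -deriveE.
rewrite [X in _ = X](@deriveMl _ _ f (k ^+ d.+1) y v); last exact: smooth_derivable sf y0.
by rewrite exprS -mulrA => /(mulfI (lt0r_neq0 k0)).
Qed.

Lemma euler (f : V -> R) d y : smooth off0 f -> off0 y ->
  (forall k y, 0 < k -> off0 y -> f (k *: y) = k ^+ d * f y) ->
  'D_y f y = d%:R * f y.
Proof.
move=> sf y0 hf; have df : differentiable f y by exact: smooth_diff sf y0.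
(* Restriction to the ray: [h |-> f ((h + 1) y)] equals [(h + 1)^d * f y] near [h = 0]. *)
have -> : 'D_y f y = 'D_1 (fun h : R => f (h *: y + y)) 0.
  rewrite /derive; set g1 := fun h => h^-1 *: _; set g2 := fun h => h^-1 *: _.
  suff -> : g1 = g2 by [].
  by apply/funext => h; rewrite /g1 /g2 /= addr0 scale0r add0r [_%:A]mulr1.
rewrite (@near_eq_derive _ _ _ _ (((fun h : R => h + 1) ^+ d) * cst (f y))).
  have dh : is_derive (0 : R) 1 (fun h : R => h + 1) (1 + 0).
    exact: (is_deriveD (is_derive_id _ _) (is_derive_cst _ _ _)).
  rewrite (@derive_val _ _ _ _ _ _ _ (is_deriveM (is_deriveX d dh) (is_derive_cst (f y) _ _))).
  by rewrite scaler0 add0r !scaleRE /= add0r addr0 expr1n !mulr1 mulrC.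
near=> h; have h1 : 0 < h + 1.
  by rewrite -ltrBlDr sub0r; near: h; apply: lt_nbhsr; rewrite oppr_lt0.
rewrite -[X in _ + X]scale1r -scalerDl hf// /=.
by rewrite exprfctE.
Unshelve. all: by end_near. Qed.

Definition grad y : V := \row_j 'D_(delta_mx 0 j) L y.

Definition gauge_pt y : V := (Num.sqrt (2 * L y))^-1 *: y.

Definition gauge_normal y : V := (Num.sqrt (dot (grad y) (grad y)))^-1 *: grad y.

Lemma dot_grad y v : off0 y -> dot (grad y) v = 'D_v L y.
Proof.
move=> y0; rewrite derive_coord; last exact: smooth_diff sL y0.
by apply: eq_bigr => j _; rewrite mxE mulrC.
Qed.

Lemma smooth_grad j : smooth off0 (fun y => grad y 0 j).
Proof.
rewrite (_ : (fun y => _) = 'D_(delta_mx 0 j) L); first exact: smooth_derive.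
by apply/funext => y; rewrite mxE.
Qed.

Lemma derive_hom1 k y v : 0 < k -> off0 y -> 'D_v L (k *: y) = k * 'D_v L y.
Proof. by move=> k0 y0; rewrite (derive_hom (d := 1%N) v sL k0 y0 L_hom). Qed.

Lemma grad_hom k y : 0 < k -> off0 y -> grad (k *: y) = k *: grad y.
Proof. by move=> k0 y0; apply/rowP => j; rewrite !mxE derive_hom1. Qed.

Lemma euler_L y : off0 y -> 'D_y L y = 2 * L y.
Proof. by move=> y0; rewrite (euler (d := 2) sL y0 L_hom). Qed.

Lemma euler_dL y v : off0 y -> 'D_y ('D_v L) y = 'D_v L y.
Proof.
move=> y0; rewrite (euler (d := 1%N) (smooth_derive v sL) y0) ?mul1r//.
by move=> k z k0 z0; rewrite expr1 derive_hom1.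
Qed.

Lemma grad_gt0 y : off0 y -> 0 < dot (grad y) (grad y).
Proof.
move=> y0; rewrite dotuu_gt0; apply/eqP => g0.
have := dot_grad y y0; rewrite g0 dot0l euler_L// => /esym/eqP.
by rewrite mulf_eq0 pnatr_eq0 /= gt_eqF// L_gt0.
Qed.

Lemma gauge_pt_hom k y : 0 < k -> off0 y -> gauge_pt (k *: y) = gauge_pt y.
Proof.
move=> k0 y0; rewrite /gauge_pt L_hom// mulrCA sqrtrM ?sqr_ge0// sqrtr_sqr gtr0_norm//.
by rewrite scalerA invfM mulrAC mulVf ?gt_eqF// mul1r.
Qed.

Lemma gauge_normal_hom k y : 0 < k -> off0 y -> gauge_normal (k *: y) = gauge_normal y.
Proof.
move=> k0 y0; rewrite /gauge_normal grad_hom// dotZl dotZr mulrA -expr2.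
rewrite sqrtrM ?sqr_ge0// sqrtr_sqr gtr0_norm//.
by rewrite scalerA invfM mulrAC mulVf ?gt_eqF// mul1r.
Qed.

Lemma gauge_pt_rad y : off0 y -> gauge_pt (Defs.rad y) = gauge_pt y.
Proof. by move=> y0; have [k k0 ->] := rad_scale y0; exact: gauge_pt_hom. Qed.

Lemma gauge_normal_rad y : off0 y -> gauge_normal (Defs.rad y) = gauge_normal y.
Proof. by move=> y0; have [k k0 ->] := rad_scale y0; exact: gauge_normal_hom. Qed.

Lemma smooth_2L : smooth off0 (fun y => 2 * L y).
Proof. by apply: smooth_mul => //; exact: smooth_cst. Qed.

Lemma twoL_gt0 y : off0 y -> 0 < 2 * L y.
Proof. by move=> y0; rewrite mulr_gt0// L_gt0. Qed.

Lemma smooth_normsq_grad : smooth off0 (fun y => dot (grad y) (grad y)).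
Proof.
by apply: smooth_sum => // j; apply: smooth_mul => //; exact: smooth_grad.
Qed.

Lemma smooth_inv_sqrt (f : V -> R) : smooth off0 f -> (forall y, off0 y -> 0 < f y) ->
  smooth off0 (fun y => (Num.sqrt (f y))^-1).
Proof.
move=> sf f0; apply: smooth_inv => //; first by move=> y /f0; rewrite -sqrtr_gt0 => /lt0r_neq0.
exact: smooth_sqrt.
Qed.

Lemma smooth_gauge_pt j : smooth off0 (fun y => gauge_pt y 0 j).
Proof.
rewrite (_ : (fun y => _) = fun y => (Num.sqrt (2 * L y))^-1 * y 0 j); last first.
  by apply/funext => y; rewrite mxE.
apply: smooth_mul => //; last exact: smooth_coord.
by apply: smooth_inv_sqrt; [exact: smooth_2L|exact: twoL_gt0].
Qed.

Lemma smooth_gauge_normal j : smooth off0 (fun y => gauge_normal y 0 j).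
Proof.
rewrite (_ : (fun y => _) =
    fun y => (Num.sqrt (dot (grad y) (grad y)))^-1 * grad y 0 j); last first.
  by apply/funext => y; rewrite mxE.
apply: smooth_mul => //; last exact: smooth_grad.
by apply: smooth_inv_sqrt; [exact: smooth_normsq_grad|exact: grad_gt0].
Qed.

Lemma derive_inv_sqrt (f : V -> R) y v : smooth off0 f -> off0 y -> 0 < f y ->
  'D_v (fun y => (Num.sqrt (f y))^-1) y = - (Num.sqrt (f y))^-1 ^+ 3 / 2 * 'D_v f y.
Proof.
move=> sf y0 f0; have df := smooth_diff sf y0.
have s0 : Num.sqrt (f y) != 0 by rewrite gt_eqF// sqrtr_gt0.
have ds := is_derive1_sqrt f0.
rewrite deriveV//; last exact/diff_derivable/(differentiable_comp_real df ds).
rewrite (derive_comp_real _ df ds) scaleRE.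
move: ('D_v f y) (Num.sqrt _) s0 => d s s0.
by field.
Qed.

Lemma derive_scale_row (a : V -> R) (g : V -> V) y v : smooth off0 a ->
  (forall j, smooth off0 (fun z => g z 0 j)) -> off0 y ->
  'D_v (fun z => a z *: g z) y = a y *: 'D_v g y + 'D_v a y *: g y.
Proof.
move=> sa sg y0; apply/rowP => j.
have dg i : derivable (fun z => g z 0 i) y v by exact: smooth_derivable (sg i) y0.
have da : derivable a y v by exact: smooth_derivable sa y0.
have E i : (fun z => (a z *: g z) 0 i) = a * (fun z => g z 0 i).
  by apply/funext => z; rewrite mxE.
rewrite derive_row => [|i]; last by rewrite E; exact: derivableM.
by rewrite E deriveM// !mxE derive_row// !scaleRE [X in _ + X = _]mulrC.
Qed.

Lemma derive_gauge_pt p v : off0 p ->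
  'D_v gauge_pt p = (Num.sqrt (2 * L p))^-1 *: (v - ('D_v L p / (2 * L p)) *: p).
Proof.
move=> p0; have L0 := twoL_gt0 p0.
rewrite (derive_scale_row (a := fun y => (Num.sqrt (2 * L y))^-1) (g := id)) //=.
- rewrite derive_id (derive_inv_sqrt _ smooth_2L)//.
  have -> : 'D_v (fun y => 2 * L y) p = 2 * 'D_v L p.
    by apply: (@deriveMl _ _ L 2); exact: smooth_derivable sL p0.
  rewrite scalerBr scalerA -scaleNr; congr (_ + _ *: _).
  have := sqr_sqrtr (ltW L0); have : Num.sqrt (2 * L p) != 0 by rewrite gt_eqF// sqrtr_gt0.
  move: (Num.sqrt _) ('D_v L p) => s d s0 E; rewrite -E; by field.
- by apply: smooth_inv_sqrt; [exact: smooth_2L|exact: twoL_gt0].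
- by move=> j; exact: smooth_coord.
Qed.

Lemma derive_gauge_normal p v (k := (Num.sqrt (dot (grad p) (grad p)))^-1) : off0 p ->
  'D_v gauge_normal p =
  k *: 'D_v grad p - (k ^+ 3 * dot (grad p) ('D_v grad p)) *: grad p.
Proof.
move=> p0; have G0 := grad_gt0 p0.
rewrite (derive_scale_row (a := fun y => (Num.sqrt (dot (grad y) (grad y)))^-1) (g := grad)) //=.
- rewrite (derive_inv_sqrt _ smooth_normsq_grad)// -/k -[X in _ = _ + X]scaleNr; congr (_ + _ *: _).
  have dG j : derivable (fun y => grad y 0 j) p v by exact: smooth_derivable (smooth_grad j) p0.
  rewrite (derive_sum_mul (F := fun j y => grad y 0 j) (H := fun j y => grad y 0 j) dG dG).
  have -> : \sum_j (grad p 0 j * 'D_v (fun y => grad y 0 j) p +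
      'D_v (fun y => grad y 0 j) p * grad p 0 j) = 2 * dot (grad p) ('D_v grad p).
    by rewrite /dot mulr_sumr; apply: eq_bigr => j _; rewrite derive_row//; ring.
  by field.
- by apply: smooth_inv_sqrt; [exact: smooth_normsq_grad|exact: grad_gt0].
- exact: smooth_grad.
Qed.

Lemma dot_derive_grad p u v : off0 p -> dot ('D_u grad p) v = 'D_u ('D_v L) p.
Proof.
move=> p0; have dG j : derivable (fun y => grad y 0 j) p u.
  exact: smooth_derivable (smooth_grad j) p0.
rewrite (derive_eq_in u oU _ p0 (g := fun y => \sum_j v 0 j * grad y 0 j)); last first.
  by move=> y; rewrite inE => y0; rewrite -dot_grad// dotC.
rewrite (derive_dot_row v dG) dotC.
by apply: eq_bigr => j _; rewrite derive_row.
Qed.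

Lemma derive_tang p v (w := v - ('D_v L p / (2 * L p)) *: p) : off0 p -> 'D_w L p = 0.
Proof.
move=> p0; have dL := smooth_diff sL p0; have L0 := twoL_gt0 p0.
rewrite /w deriveDv// -scaleNr deriveZv// euler_L// mulNr mulfVK ?subrr// gt_eqF//.
Qed.

(* Subtracting the right multiple of [p] from [v] gives a vector [w] tangent to the level set
   of [L]; the second fundamental form at [v] is a positive multiple of the Hessian at [w]. *)
Lemma gauge_pairing p v (w := v - ('D_v L p / (2 * L p)) *: p) : off0 p ->
  exists2 k, 0 < k & dot ('D_v gauge_normal p) ('D_v gauge_pt p) = k * 'D_w ('D_w L) p.
Proof.
move=> p0; have wL : 'D_w L p = 0 by exact: derive_tang.
exists ((Num.sqrt (dot (grad p) (grad p)))^-1 * (Num.sqrt (2 * L p))^-1).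
  by rewrite mulr_gt0// invr_gt0 sqrtr_gt0 ?grad_gt0// twoL_gt0.
rewrite derive_gauge_pt// derive_gauge_normal// -/w dotZr dotBl !dotZl.
rewrite (dot_grad w p0) wL mulr0 subr0 (dot_derive_grad v w p0).
(* [v] and [w] differ by a multiple of [p], and ['D_p ('D_w L) p = 'D_w L p = 0] by Euler's relation
   and tangency. *)
have -> : 'D_v ('D_w L) p = 'D_w ('D_w L) p.
  have dwL : differentiable ('D_w L) p by exact: smooth_diff (smooth_derive w sL) p0.
  have vE : v = w + ('D_v L p / (2 * L p)) *: p by rewrite /w subrK.
  by rewrite [X in 'D_X _ _ = _]vE deriveDv// deriveZv// euler_dL// wL mulr0 addr0.
by ring.
Qed.

Lemma gauge_pt_radial p : off0 p -> 'D_p gauge_pt p = 0.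
Proof.
move=> p0; rewrite derive_gauge_pt// euler_L// mulfV ?gt_eqF ?twoL_gt0//.
by rewrite scale1r subrr scaler0.
Qed.

Lemma dot_gauge_normal_derive p v : off0 p ->
  dot (gauge_normal p) ('D_v gauge_normal p) = 0.
Proof.
move=> p0; have G0 := grad_gt0 p0.
rewrite derive_gauge_normal// /gauge_normal dotZl dotBr !dotZr.
have := sqr_sqrtr (ltW G0).
have : Num.sqrt (dot (grad p) (grad p)) != 0 by rewrite gt_eqF// sqrtr_gt0.
move: (Num.sqrt _) (dot _ ('D_v _ p)) => s d s0 <-; by field.
Qed.

Lemma gauge_normal_radial p : off0 p -> 'D_p gauge_normal p = 0.
Proof.
move=> p0; have G0 := grad_gt0 p0.
have E : 'D_p grad p = grad p.
  apply/rowP => j; rewrite derive_row => [|i].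
    rewrite mxE (_ : (fun z => _) = 'D_(delta_mx 0 j) L) ?euler_dL//.
    by apply/funext => z; rewrite mxE.
  exact: smooth_derivable (smooth_grad i) p0.
rewrite derive_gauge_normal// E -scalerBl.
have := sqr_sqrtr (ltW G0).
have : Num.sqrt (dot (grad p) (grad p)) != 0 by rewrite gt_eqF// sqrtr_gt0.
move: (Num.sqrt _) => s s0 <-.
by rewrite (_ : _ - _ = 0) ?scale0r//; field.
Qed.

Lemma dot_gauge_normal_pt p v : off0 p -> dot (gauge_normal p) ('D_v gauge_pt p) = 0.
Proof.
move=> p0; have := derive_tang v p0; rewrite -(dot_grad _ p0) => E.
by rewrite derive_gauge_pt// /gauge_normal dotZl dotZr E !mulr0.
Qed.

Lemma gauge_normal_unit p : off0 p -> dot (gauge_normal p) (gauge_normal p) = 1.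
Proof.
move=> p0; have G0 := grad_gt0 p0; rewrite /gauge_normal dotZl dotZr.
rewrite -[X in _ * (_ * X)](sqr_sqrtr (ltW G0)).
have : Num.sqrt (dot (grad p) (grad p)) != 0 by rewrite gt_eqF// sqrtr_gt0.
by move: (Num.sqrt _) => s s0; field.
Qed.

Lemma derive_gauge_pt_eq0 p v : off0 p -> 'D_v gauge_pt p = 0 ->
  v = ('D_v L p / (2 * L p)) *: p.
Proof.
move=> p0; rewrite derive_gauge_pt// => /eqP; rewrite scaler_eq0 invr_eq0.
by rewrite gt_eqF ?sqrtr_gt0 ?twoL_gt0//= subr_eq0 => /eqP.
Qed.

Lemma immersion_gauge_pt : immersion gauge_pt.
Proof.
split; first exact: smooth_on_sphere_row smooth_gauge_pt gauge_pt_rad.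
move=> p Sp v vp v0; have p0 := sphere_off0 Sp.
rewrite (dsphE gauge_pt_rad)//; apply/eqP => /(derive_gauge_pt_eq0 p0) vE.
move: vp v0; rewrite vE dotZl (_ : dot p p = 1)// mulr1 => ->.
by rewrite scale0r eqxx.
Qed.

Lemma gauss_map_gauge_normal : gauss_map gauge_pt gauge_normal.
Proof.
split; first exact: smooth_on_sphere_row smooth_gauge_normal gauge_normal_rad.
move=> p Sp; have p0 := sphere_off0 Sp; split; first exact: gauge_normal_unit.
by move=> v _; rewrite (dsphE gauge_pt_rad)// dot_gauge_normal_pt.
Qed.

Lemma mulmx_dN p u : off0 p -> u *m dN_mx gauge_normal p = 'D_u gauge_normal p.
Proof.
move=> p0.
have := derive_mulmx smooth_gauge_normal gauge_normal_rad gauge_normal_radial 0 u p0.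
move=> H; apply: etrans (etrans H _); last by rewrite scaler0 addr0.
congr (_ *m _); apply/row_matrixP => i.
by rewrite !rowK scaler0 addr0.
Qed.

Lemma mulmx_ext_dN p u : off0 p ->
  u *m ext_dN gauge_normal p = 'D_u gauge_normal p + dot u p *: gauge_normal p.
Proof.
exact: (derive_mulmx smooth_gauge_normal gauge_normal_rad gauge_normal_radial).
Qed.

Lemma mulmx_ext_dx p u : off0 p ->
  u *m ext_dx gauge_pt gauge_normal p = 'D_u gauge_pt p + dot u p *: gauge_normal p.
Proof. exact: (derive_mulmx smooth_gauge_pt gauge_pt_rad gauge_pt_radial). Qed.

(** Pairing a kernel vector with the normal isolates [dot u p], which must vanish; what remains is
    injectivity of the differential on the tangent space. *)
Lemma ext_dx_unit p : sphere p -> ext_dx gauge_pt gauge_normal p \in unitmx.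
Proof.
move=> Sp; have p0 := sphere_off0 Sp; rewrite -row_free_unit.
apply: inj_row_free => u; rewrite mulmx_ext_dx// => E.
have up : dot u p = 0.
  have := congr1 (dot (gauge_normal p)) E.
  by rewrite dotDr dotZr gauge_normal_unit// dot_gauge_normal_pt// dot0r add0r mulr1.
move: E; rewrite up scale0r addr0 => /(derive_gauge_pt_eq0 p0) uE.
by move: up; rewrite uE dotZl (_ : dot p p = 1)// mulr1 => ->; rewrite scale0r.
Qed.

(** * From the sign of the Hessian to curvature and rank *)

Section HessianSign.
Variables (Z : set V) (e : V).
Hypothesis hess_gt0 : forall p w, sphere p -> ~ Z p -> w != 0 -> 0 < 'D_w ('D_w L) p.
Hypothesis hess_ge0 : forall p w, sphere p -> Z p -> 0 <= 'D_w ('D_w L) p.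
Hypothesis hess_eq0 : forall p w, sphere p -> Z p -> 'D_w ('D_w L) p = 0 ->
  exists t, w = t *: e.
Hypothesis hess_e : forall p w, sphere p -> Z p -> 'D_e ('D_w L) p = 0.
Hypothesis indep_e : forall p a b, sphere p -> Z p -> a *: p + b *: e = 0 -> a = 0 /\ b = 0.

Lemma hess_ge0_sphere p w : sphere p -> 0 <= 'D_w ('D_w L) p.
Proof.
move=> Sp; have [Zp|Zp] := pselect (Z p); first exact: hess_ge0.
have [->|w0] := eqVneq w 0; first by rewrite derive0.
exact/ltW/hess_gt0.
Qed.

Lemma derive_gauge_normal_e p : sphere p -> Z p -> 'D_e gauge_normal p = 0.
Proof.
move=> Sp Zp; have p0 := sphere_off0 Sp.
have E : 'D_e grad p = 0.
  by apply/rowP => j; rewrite -coord_dot dot_derive_grad// hess_e// mxE.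
by rewrite derive_gauge_normal// E dot0r mulr0 scaler0 scale0r subrr.
Qed.

(** Pairing the equation with ['D_u gauge_pt p] gives [- t |dx u|^2 = k Hess (w, w)] with [k > 0], a
    nonpositive number equal to a nonnegative one. If [t > 0] then [dx u = 0]; off [Z] the Hessian
    is definite and [w = 0]. Either way [u] is a multiple of [p], hence zero. Taking [t > 0] gives
    the sign of the curvature, and [t = 0] its nonvanishing off [Z]. *)
Lemma dN_negative_eigen p t u : sphere p -> 0 <= t -> dot u p = 0 ->
  'D_u gauge_normal p = - t *: 'D_u gauge_pt p -> 0 < t \/ ~ Z p -> u = 0.
Proof.
move=> Sp t0 up E tZ; have p0 := sphere_off0 Sp.
have [k k0 kE] := gauge_pairing u p0.
move: kE; rewrite E dotZl; set w := u - _ => kE.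
have w0 : w = 0.
  have B0 := hess_ge0_sphere w Sp.
  have X0 := dotuu_ge0 ('D_u gauge_pt p).
  case: tZ => [t1|Zp].
    have : dot ('D_u gauge_pt p) ('D_u gauge_pt p) = 0 by nra.
    move=> /eqP; rewrite dotuu_eq0 => /eqP /(derive_gauge_pt_eq0 p0) uE.
    by rewrite /w -uE subrr.
  apply/eqP; apply: contraT => wn0; have := hess_gt0 Sp Zp wn0.
  by move=> B1; nra.
move/eqP: w0; rewrite subr_eq0 => /eqP uE.
by move: up; rewrite uE dotZl (_ : dot p p = 1)// mulr1 => ->; rewrite scale0r.
Qed.

Lemma gauss_kronecker_eigen p t u : sphere p -> 0 <= t -> 0 < t \/ ~ Z p ->
  u *m (ext_dN gauge_normal p *m invmx (ext_dx gauge_pt gauge_normal p)) = - t *: u ->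
  u = 0.
Proof.
move=> Sp t0 tZ; have p0 := sphere_off0 Sp.
move=> /(mul_invmx_eigen (ext_dx_unit Sp)) H.
have E : 'D_u gauge_normal p + dot u p *: gauge_normal p =
    - t *: ('D_u gauge_pt p + dot u p *: gauge_normal p).
  exact: etrans (esym (mulmx_ext_dN u p0)) (etrans H (congr1 _ (mulmx_ext_dx u p0))).
(* The normal component of [E] reads [dot u p = - t * dot u p], with [t >= 0]. *)
have up : dot u p = 0.
  have := congr1 (dot (gauge_normal p)) E.
  rewrite dotDr (dotZr (- t)) dotDr (dotZr (dot u p)) (gauge_normal_unit p0).
  rewrite (dot_gauge_normal_derive u p0) (dot_gauge_normal_pt u p0) mulr1 !add0r => H1.
  have /eqP : (1 + t) * dot u p = 0 by rewrite mulrDl mul1r {1}H1 mulNr addNr.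
  by rewrite mulf_eq0 gt_eqF ?ltr_wpDr//= => /eqP.
by move: E; rewrite up !scale0r !addr0 => /(dN_negative_eigen Sp t0 up); exact.
Qed.

Lemma gauss_kronecker_ge0 p : sphere p -> 0 <= gauss_kronecker gauge_pt gauge_normal p.
Proof.
move=> Sp; apply: det_ge0 => t v t0.
by apply: gauss_kronecker_eigen => //; [exact: ltW|left].
Qed.

Lemma gauss_kronecker_eq0 p : sphere p ->
  gauss_kronecker gauge_pt gauge_normal p = 0 <-> Z p.
Proof.
move=> Sp; have p0 := sphere_off0 Sp; split=> [/eqP/det0P[v v0 vE]|Zp].
  apply: contrapT => Zp; move/eqP: v0; apply.
  apply: (@gauss_kronecker_eigen p 0) => //; first by right.
  by rewrite vE oppr0 scale0r.
rewrite /gauss_kronecker det_mulmx (_ : \det (ext_dN _ _) = 0) ?mul0r//.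
(* The kernel vector is the axis made tangent to the sphere: nonzero by [indep_e], and killed
   because the derivative of the normal vanishes both along [e] and along [p]. *)
apply/eqP/det0P; exists (e - dot e p *: p).
  apply/eqP => E; have := @indep_e p (- dot e p) 1 Sp Zp.
  by rewrite scale1r scaleNr addrC => /(_ E)[_ /eqP]; rewrite oner_eq0.
rewrite mulmx_ext_dN// dotBl dotZl (_ : dot p p = 1)// mulr1 subrr scale0r addr0.
have dN := differentiable_sphere_map smooth_gauge_normal p0.
have -> : 'D_(e - dot e p *: p) gauge_normal p =
    'D_e gauge_normal p - dot e p *: 'D_p gauge_normal p.
  by rewrite !(deriveE _ dN) linearB linearZ.
by rewrite (derive_gauge_normal_e Sp Zp) (gauge_normal_radial p0) scaler0 subrr.
Qed.

(** If the differential of the normal kills [u], the pairing makes [w] null for the Hessian, so [w]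
    is a multiple of [e] on [Z] and zero elsewhere; in both cases [u] lies in the span of [p] and
    [e]. *)
Lemma rank_dN_ge p : sphere p -> (m - 2 <= rank_dN gauge_normal p)%N.
Proof.
move=> Sp; have p0 := sphere_off0 Sp.
apply: (@rank_ge_span _ _ _ p e) => u; rewrite mulmx_dN// => E.
have [k k0] := gauge_pairing u p0; rewrite E dot0l; set w := u - _ => kE.
have {kE} wE : 'D_w ('D_w L) p = 0.
  by apply/eqP; move/esym/eqP: kE; rewrite mulf_eq0 gt_eqF.
have uE : u = ('D_u L p / (2 * L p)) *: p + w by rewrite /w addrC subrK.
have [Zp|Zp] := pselect (Z p).
  have [t wt] := hess_eq0 Sp Zp wE.
  by exists ('D_u L p / (2 * L p)), t; rewrite -wt.
have w0 : w = 0.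
  by apply/eqP; apply: contraT => wn0; have := hess_gt0 Sp Zp wn0; rewrite wE ltxx.
by exists ('D_u L p / (2 * L p)), 0; rewrite scale0r addr0 {1}uE w0 addr0.
Qed.

Lemma rank_dN_le p : sphere p -> Z p -> (rank_dN gauge_normal p <= m - 2)%N.
Proof.
move=> Sp Zp; have p0 := sphere_off0 Sp.
apply: (@rank_le_span _ _ _ p e); rewrite ?mulmx_dN//.
- exact: gauge_normal_radial.
- exact: derive_gauge_normal_e.
- by move=> a b; exact: indep_e.
Qed.

End HessianSign.
End Gauge.

(** * Composites with flat functions and the calculus of second derivatives *)

Section SmoothFlat.
Context {R : realType} {V : normedModType R}.
Implicit Types (U : set V) (f g : V -> R) (y u v : V).

Lemma Ck_flat U k f P : open U -> Ck U k f -> Ck U k (fun y => flat P (f y)).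
Proof.
move=> oU; elim: k P => [//|k IH] P Cf; have [df Df] := Cf; split=> [y Uy|v].
  exact: differentiable_comp_real (df _ Uy) (is_derive_flat P _).
apply: (Ck_eq_in oU _ (Ck_mul oU (IH (flatD P) (Ck_le Cf)) (Df v))) => y.
by rewrite inE => Uy; rewrite (derive_comp_real _ (df _ Uy) (is_derive_flat P _)).
Qed.

Lemma smooth_flat U f P : open U -> smooth U f -> smooth U (fun y => flat P (f y)).
Proof. by move=> oU sf k; exact: Ck_flat. Qed.

Lemma open_gt0 f : smooth setT f -> open [set y | 0 < f y].
Proof.
move=> sf; apply: (@open_comp _ _ f [set x | 0 < x]); last exact: open_gt.
by move=> y _; apply: differentiable_continuous; exact: smooth_diff sf _.
Qed.

(* The data needed to compute the mixed second derivative of a product or composite. *)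
Definition jet U f y u v (fu fv fuv : R) : Prop :=
  [/\ smooth U f, 'D_u f y = fu, 'D_v f y = fv & 'D_u ('D_v f) y = fuv].

Section Jet.
Variables (U : set V) (y u v : V).
Hypotheses (oU : open U) (Uy : U y).

Lemma jet_cst (c : R) : jet U (fun=> c) y u v 0 0 0.
Proof.
have D w : 'D_w (fun _ : V => c) = fun=> 0 by apply/funext => z; exact: derive_cst.
by split; [exact: smooth_cst|exact: derive_cst|exact: derive_cst|rewrite D derive_cst].
Qed.

Lemma jet_linear f : (forall z, differentiable f z) ->
  (forall k w z, f (k *: w + z) = k * f w + f z) -> jet U f y u v (f u) (f v) 0.
Proof.
move=> df lf; have D w : 'D_w f = fun=> f w.
  by apply/funext => z; exact: derive_linear.
by split; [apply: smooth_linear|exact: derive_linear|exact: derive_linear|rewrite D derive_cst].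
Qed.

Lemma jet_add f g fu fv fuv gu gv guv :
  jet U f y u v fu fv fuv -> jet U g y u v gu gv guv ->
  jet U (fun z => f z + g z) y u v (fu + gu) (fv + gv) (fuv + guv).
Proof.
move=> [sf <- <- <-] [sg <- <- <-].
have D w : {in U, 'D_w (fun z => f z + g z) =1 (fun z => 'D_w f z + 'D_w g z)}.
  move=> z; rewrite inE => Uz.
  by rewrite [LHS](@deriveD _ _ _ f g)//; exact: smooth_derivable Uz.
have Uy' : y \in U by rewrite inE.
split; [exact: smooth_add|exact: (D u _ Uy')|exact: (D v _ Uy')|].
rewrite (derive_eq_in u oU (D v) Uy).
rewrite [LHS](@deriveD _ _ _ ('D_v f) ('D_v g))//.
  exact: smooth_derivable (smooth_derive v sf) Uy.
exact: smooth_derivable (smooth_derive v sg) Uy.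
Qed.

Lemma jet_mul f g fu fv fuv gu gv guv :
  jet U f y u v fu fv fuv -> jet U g y u v gu gv guv ->
  jet U (fun z => f z * g z) y u v (f y * gu + fu * g y) (f y * gv + fv * g y)
    (f y * guv + fu * gv + fv * gu + g y * fuv).
Proof.
move=> [sf <- <- <-] [sg <- <- <-].
have D w : 'D_w (fun z => f z * g z) y = f y * 'D_w g y + 'D_w f y * g y.
  rewrite [LHS](@deriveM _ _ f g); try exact: smooth_derivable Uy.
  by rewrite !scaleRE [X in _ + X = _]mulrC.
by split; [exact: smooth_mul|exact: D|exact: D|exact: (derive2_mul u v oU sf sg Uy)].
Qed.

Lemma jet_comp (phi phi' phi'' : R -> R) f fu fv fuv :
  smooth U (fun z => phi (f z)) ->
  (forall z, U z -> is_derive (f z) 1 phi (phi' (f z))) ->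
  is_derive (f y) 1 phi' (phi'' (f y)) ->
  jet U f y u v fu fv fuv ->
  jet U (fun z => phi (f z)) y u v (phi' (f y) * fu) (phi' (f y) * fv)
    (phi'' (f y) * fu * fv + phi' (f y) * fuv).
Proof.
move=> sphi p1 p2 [sf <- <- <-]; have df := smooth_diff sf Uy.
split=> //; last exact: derive2_comp oU sf Uy p1 p2.
  exact: derive_comp_real df (p1 _ Uy).
exact: derive_comp_real df (p1 _ Uy).
Qed.

Lemma jet_flat P f fu fv fuv : jet U f y u v fu fv fuv ->
  jet U (fun z => flat P (f z)) y u v (flat (flatD P) (f y) * fu)
    (flat (flatD P) (f y) * fv)
    (flat (flatD (flatD P)) (f y) * fu * fv + flat (flatD P) (f y) * fuv).
Proof.
move=> J; have [sf _ _ _] := J.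
apply: (jet_comp (phi' := flat (flatD P)) (phi'' := flat (flatD (flatD P)))) J.
- exact: smooth_flat.
- by move=> z _; exact: is_derive_flat.
- exact: is_derive_flat.
Qed.

Lemma jet_inv f fu fv fuv : (forall z, U z -> f z != 0) -> jet U f y u v fu fv fuv ->
  jet U (fun z => (f z)^-1) y u v (- (f y)^-1 ^+ 2 * fu) (- (f y)^-1 ^+ 2 * fv)
    (2 * (f y)^-1 ^+ 3 * fu * fv - (f y)^-1 ^+ 2 * fuv).
Proof.
move=> f0 J; have [sf _ _ _] := J.
have dV z : U z -> is_derive (f z) 1 (fun x : R => x^-1) (- (f z)^-1 ^+ 2).
  move=> /f0 fz; have := @is_deriveV _ id (f z) 1 1 fz (is_derive_id _ _).
  by rewrite [_ *: _]mulr1 exprVn.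
rewrite -[X in jet _ _ _ _ _ _ _ (_ + X)]mulNr.
apply: (jet_comp (phi := fun x => x^-1) (phi' := fun x => - x^-1 ^+ 2)
  (phi'' := fun x => 2 * x^-1 ^+ 3)) => //; first exact: smooth_inv.
apply: is_derive_eq (is_deriveN (is_deriveX 2 (dV y Uy))) _.
by rewrite !scaleRE /=; ring.
Qed.

Lemma jet_inv_sqrt f fu fv fuv (k := (Num.sqrt (f y))^-1) :
  (forall z, U z -> 0 < f z) -> jet U f y u v fu fv fuv ->
  jet U (fun z => (Num.sqrt (f z))^-1) y u v (- k ^+ 3 / 2 * fu) (- k ^+ 3 / 2 * fv)
    (3 / 4 * k ^+ 5 * fu * fv - k ^+ 3 / 2 * fuv).
Proof.
move=> f0 J; have [sf _ _ _] := J.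
have dV x : 0 < x -> is_derive (x : R) 1 (fun x : R => (Num.sqrt x)^-1)
    (- (Num.sqrt x)^-1 ^+ 3 / 2).
  move=> x0; have s0 : Num.sqrt x != 0 by rewrite gt_eqF// sqrtr_gt0.
  have := @is_deriveV _ Num.sqrt x _ 1 s0 (is_derive1_sqrt x0).
  move=> H; apply: is_derive_eq H _; rewrite scaleRE.
  by move: (Num.sqrt x) s0 => s s0; field.
rewrite (_ : - k ^+ 3 / 2 = (fun x : R => - (Num.sqrt x)^-1 ^+ 3 / 2) (f y))//.
rewrite (_ : 3 / 4 * k ^+ 5 = (fun x => 3 / 4 * (Num.sqrt x)^-1 ^+ 5) (f y))//.
rewrite -[X in jet _ _ _ _ _ _ _ (_ + X)]mulNr -[X in jet _ _ _ _ _ _ _ (_ + X * _)]mulNr.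
apply: (jet_comp (phi := fun x => (Num.sqrt x)^-1)
  (phi' := fun x => - (Num.sqrt x)^-1 ^+ 3 / 2)
  (phi'' := fun x => 3 / 4 * (Num.sqrt x)^-1 ^+ 5)) => //.
- apply: smooth_inv => //; last exact: smooth_sqrt.
  by move=> z /f0; rewrite -sqrtr_gt0 => /lt0r_neq0.
- by move=> z /f0; exact: dV.
have d3 := is_deriveX 3 (dV _ (f0 _ Uy)).
have := is_deriveM (is_deriveN d3) (is_derive_cst (2^-1 : R) (f y) 1).
move=> H; apply: is_derive_eq H _.
by rewrite scaler0 add0r !scaleRE /=; move: ((Num.sqrt (f y))^-1) => t; field.
Qed.

End Jet.
End SmoothFlat.

(** * The perturbed cylinder *)

Section FlatBounds.
Context {R : realType}.
Implicit Types x : R.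

Lemma flat_polyE (P : {poly R}) x : 0 < x -> flat P x = P.[x^-1] * expR (- x^-1).
Proof. by rewrite /flat => ->. Qed.

Lemma flatD1 : flatD (1 : {poly R}) = 'X^2.
Proof. by rewrite /flatD derivC subr0 mulr1. Qed.

Lemma flat1_gt0 x : 0 < x -> 0 < flat 1 x.
Proof. by move=> x0; rewrite flat_polyE// hornerC mul1r expR_gt0. Qed.

Lemma flat1_ge0 x : 0 <= flat 1 x.
Proof. by have [/flat1_gt0/ltW|/flat_le0->] := ltP 0 x. Qed.

Lemma flat1_eq0 x : flat 1 x = 0 -> x <= 0.
Proof. by case: (ltP 0 x) => // /flat1_gt0/lt0r_neq0/eqP. Qed.

Lemma flat1_le x y : x <= y -> flat 1 x <= flat 1 y.
Proof.
move=> xy; have [x0|x0] := ltP 0 x; last by rewrite (flat_le0 _ x0) flat1_ge0.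
have y0 := lt_le_trans x0 xy; rewrite !flat_polyE// !hornerC !mul1r ler_expR lerN2.
by rewrite lef_pV2.
Qed.

Lemma flatD1_ge0 x : 0 <= flat (flatD 1) x.
Proof.
have [x0|/flat_le0->//] := ltP 0 x.
by rewrite flat_polyE// flatD1 hornerXn mulr_ge0 ?expR_ge0// sqr_ge0.
Qed.

Lemma flatD1_le2 x : flat (flatD 1) x <= 2.
Proof.
have [x0|/flat_le0->//] := ltP 0 x.
rewrite flat_polyE// flatD1 hornerXn (le_trans (exprM_expRN_le 2 _))//.
by rewrite invr_ge0 ltW.
Qed.

(** With [u = 1/x] this is [u^4 exp (-2u) <= 4! exp (-u)]. It is the source of the control of the
    gradient of the bump by the bump itself. *)
Lemma flatD1_sqr_le x : flat (flatD 1) x ^+ 2 <= 24 * flat 1 x.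
Proof.
have [x0|x0] := ltP 0 x; last by rewrite !(flat_le0 _ x0) expr0n mulr0.
rewrite !flat_polyE// flatD1 hornerXn hornerC mul1r exprMn -exprM [X in _ * X]expr2 mulrA.
rewrite ler_wpM2r ?expR_ge0// (le_trans (exprM_expRN_le 4 _))//.
by rewrite invr_ge0 ltW.
Qed.

Lemma flatDD1E x : 0 < x ->
  flat (flatD (flatD 1)) x = x^-1 ^+ 3 * (x^-1 - 2) * expR (- x^-1).
Proof.
move=> x0; rewrite flat_polyE// flatD1 /flatD derivXn /= hornerM hornerXn hornerD hornerN.
by rewrite hornerMn !hornerXn; ring.
Qed.

(** The sign is that of [1/x - 2]. This explains the argument [(1 - rho) / 2] in [cap]: it never
    exceeds [1/2], so it stays in the range of convexity. *)
Lemma flatDD1_ge0 x : x <= 2^-1 -> 0 <= flat (flatD (flatD 1)) x.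
Proof.
move=> x2; have [x0|/flat_le0->//] := ltP 0 x.
have xV : 0 < x^-1 by rewrite invr_gt0.
rewrite flatDD1E//; apply: mulr_ge0; last exact: expR_ge0.
apply: mulr_ge0; first by rewrite exprn_ge0// ltW.
by rewrite subr_ge0 -[2]invrK lef_pV2 ?posrE// invr_gt0.
Qed.

(** [36 = 4! + 2 * 3!], one summand for each monomial of [u^4 - 2 u^3] with [u = 1/x]. *)
Lemma flatDD1_norm_le x : `|flat (flatD (flatD 1)) x| <= 36.
Proof.
have [x0|/flat_le0->] := ltP 0 x; last by rewrite normr0.
have u0 : 0 <= x^-1 by rewrite invr_ge0 ltW.
rewrite flatDD1E//.
have h4 := exprM_expRN_le 4 u0; have h3 := exprM_expRN_le 3 u0.
have p4 : 0 <= x^-1 ^+ 4 * expR (- x^-1) by rewrite mulr_ge0 ?expR_ge0 ?exprn_ge0.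
have p3 : 0 <= x^-1 ^+ 3 * expR (- x^-1) by rewrite mulr_ge0 ?expR_ge0 ?exprn_ge0.
rewrite (_ : _ * _ = x^-1 ^+ 4 * expR (- x^-1) - 2 * (x^-1 ^+ 3 * expR (- x^-1))); last by ring.
move: h4 h3 p4 p3; rewrite -[(4`!)%N]/24%N -[(3`!)%N]/6%N.
move: (_ ^+ 4 * _) (_ ^+ 3 * _) => a b h4 h3 p4 p3.
by rewrite ler_norml; lra.
Qed.

End FlatBounds.

(** * Height and horizontal part of a point, and the caps *)

Section Coordinates.
Context {R : realType} {n : nat}.
Local Notation V := 'rV[R]_(1 + n).
Implicit Types (y u v w : V) (U : set V).

Definition ht y : R := lsubmx y 0 0.
Definition tl y : 'rV[R]_n := rsubmx y.
Definition r2 y : R := dot (tl y) (tl y).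

Lemma htD k u v : ht (k *: u + v) = k * ht u + ht v.
Proof. by rewrite /ht !mxE. Qed.

Lemma tlD k u v : tl (k *: u + v) = k *: tl u + tl v.
Proof. by apply/rowP => j; rewrite !mxE. Qed.

Lemma htZ k u : ht (k *: u) = k * ht u.
Proof. by rewrite /ht !mxE. Qed.

Lemma tlZ k u : tl (k *: u) = k *: tl u.
Proof. by apply/rowP => j; rewrite !mxE. Qed.

Lemma r2_ge0 y : 0 <= r2 y.
Proof. exact: dotuu_ge0. Qed.

Lemma dot_split u v : dot u v = ht u * ht v + dot (tl u) (tl v).
Proof.
rewrite /dot big_split_ord big_ord1 /ht !mxE; congr (_ + _).
by apply: eq_bigr => j _; rewrite !mxE.
Qed.

Lemma ht_tl_eq0 y : ht y = 0 -> tl y = 0 -> y = 0.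
Proof.
move=> h t; rewrite -[y]hsubmxK -/(tl y) t (mx11_scalar (lsubmx y)) -/(ht y) h.
by rewrite raddf0 row_mx0.
Qed.

Lemma off0_ht_r2 y : off0 y -> ht y = 0 -> 0 < r2 y.
Proof.
move=> y0 h; rewrite dotuu_gt0; apply/eqP => t.
by move/eqP: y0; apply; exact: ht_tl_eq0.
Qed.

Lemma differentiable_ht y : differentiable ht y.
Proof.
rewrite (_ : ht = fun y => y 0 (lshift n 0)); first exact: differentiable_coord.
by apply/funext => z; rewrite /ht mxE.
Qed.

Lemma smooth_tl U j : smooth U (fun y => tl y 0 j).
Proof.
rewrite (_ : (fun y => _) = fun y => y 0 (rshift 1 j)); first exact: smooth_coord.
by apply/funext => z; rewrite /tl mxE.
Qed.

Lemma smooth_ht U : smooth U ht.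
Proof. by apply: smooth_linear => [y|k u w]; [exact: differentiable_ht|exact: htD]. Qed.

Lemma jet_ht U y u v : open U -> U y -> jet U ht y u v (ht u) (ht v) 0.
Proof.
by move=> oU Uy; apply: jet_linear => // [z|k w z]; [exact: differentiable_ht|exact: htD].
Qed.

Lemma jet_dot_tl U (b : 'rV[R]_n) y u v : open U -> U y ->
  jet U (fun z => dot b (tl z)) y u v (dot b (tl u)) (dot b (tl v)) 0.
Proof.
move=> oU Uy; apply: jet_linear => // [z|k w z]; last by rewrite tlD dotDr dotZr.
have oT : open [set: V] by exact: openT.
exact: smooth_diff (smooth_dot_row oT (smooth_tl setT) b) I.
Qed.

Lemma smooth_r2 U : open U -> smooth U r2.
Proof. by move=> oU; apply: smooth_sum => // j; apply: smooth_mul => //; exact: smooth_tl. Qed.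

Lemma derive_r2 w : 'D_w r2 = fun z => 2 * dot (tl z) (tl w).
Proof.
apply/funext => z.
have dt j : derivable (fun y => tl y 0 j) z w.
  exact: (@smooth_derivable _ _ setT _ _ _ (smooth_tl setT j) I).
have Dt j : 'D_w (fun y => tl y 0 j) z = tl w 0 j.
  by apply: derive_linear => k u v; rewrite tlD !mxE.
rewrite /r2 /dot (derive_sum_mul (F := fun j y => tl y 0 j) (H := fun j y => tl y 0 j) dt dt).
by rewrite mulr_sumr; apply: eq_bigr => j _; rewrite Dt; ring.
Qed.

Lemma jet_r2 U y u v : open U -> U y ->
  jet U r2 y u v (2 * dot (tl y) (tl u)) (2 * dot (tl y) (tl v)) (2 * dot (tl u) (tl v)).
Proof.
move=> oU Uy; split; first exact: smooth_r2.
- exact: (congr1 (fun f => f y) (derive_r2 u)).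
- exact: (congr1 (fun f => f y) (derive_r2 v)).
rewrite derive_r2; apply: (@derive_linear _ _ (fun z => 2 * dot (tl z) (tl v))) => k w z.
by rewrite tlD dotDl dotZl; ring.
Qed.

Lemma open_ht_neq0 : open [set y : V | ht y != 0].
Proof.
rewrite (_ : [set y | _] = [set y | 0 < ht y * ht y]).
  apply: open_gt0; apply: smooth_mul; [exact: openT|exact: smooth_ht|exact: smooth_ht].
by apply/seteqP; split=> y /=; rewrite -expr2 lt_def sqr_ge0 sqrf_eq0 andbT.
Qed.

Lemma open_cone (a b : R) : open [set y : V | 0 < a * r2 y + b * ht y ^+ 2].
Proof.
have oT : open [set: V] by exact: openT.
apply: open_gt0; apply: smooth_add => //; apply: smooth_mul => //.
- exact: smooth_cst.
- exact: smooth_r2.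
- exact: smooth_cst.
- by apply: smooth_exp => //; exact: smooth_ht.
Qed.

(* [ht ^ 2 * psi (r2 / ht ^ 2)] with [psi] convex, decreasing, and zero exactly on
   [1, +oo[: it bends the cylinder [r2 = 1] into caps outside the band [ht ^ 2 <= r2]. At
   [ht = 0] the quotient is the junk value [0], but the factor [ht ^ 2] vanishes. *)
Definition cap y : R := 8^-1 * ht y ^+ 2 * flat 1 ((1 - r2 y / ht y ^+ 2) / 2).

Lemma cap_eq0 y : ht y ^+ 2 <= r2 y -> cap y = 0.
Proof.
move=> h; have [s0|s0] := eqVneq (ht y) 0; first by rewrite /cap s0 expr0n mulr0 mul0r.
have s2 : 0 < ht y ^+ 2 by rewrite lt_def sqrf_eq0 s0 sqr_ge0.
rewrite /cap flat_le0 ?mulr0// pmulr_lle0// subr_le0.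
by rewrite ler_pdivlMr// mul1r.
Qed.

Lemma cap_ge0 y : 0 <= cap y.
Proof. by rewrite /cap mulr_ge0 ?flat1_ge0// mulr_ge0// ?sqr_ge0// invr_ge0. Qed.

(** Near the equatorial hyperplane the function vanishes identically; away from it the division by
    [ht y ^+ 2] is genuine. *)
Lemma smooth_cap : smooth (@off0 R (1 + n)) cap.
Proof.
apply: smooth_local => y y0; have [h|h] := eqVneq (ht y) 0.
  exists [set y : V | 0 < 1 * r2 y + - 1 * ht y ^+ 2].
  split; first by rewrite /= h expr0n mulr0 addr0 mul1r off0_ht_r2.
  apply: (@smooth_eq_in _ _ _ (fun=> 0)); [exact: open_cone| |exact: smooth_cst].
  by move=> z; rewrite inE /= mul1r mulN1r subr_gt0 => /ltW/cap_eq0.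
exists [set y | ht y != 0]; split=> //; have oU := open_ht_neq0.
have s2 : smooth [set y : V | ht y != 0] (fun y => ht y ^+ 2).
  by apply: smooth_exp => //; exact: smooth_ht.
apply: smooth_mul => //; first by apply: smooth_mul => //; exact: smooth_cst.
apply: smooth_flat => //; apply: smooth_mul => //; last exact: smooth_cst.
apply: smooth_sub_fun => //; first exact: smooth_cst.
apply: smooth_mul => //; first exact: smooth_r2.
by apply: smooth_inv => // z /=; rewrite sqrf_eq0.
Qed.

(** [- zeta] is the differential of the argument [x]. In this grouping, for [u = v], the middle term
    alone is negative, and the factor [8^-1] in [cap] keeps it within a quarter of [|dz|^2]. *)
Lemma cap_hessian y u v : ht y != 0 ->
  let rho := r2 y / ht y ^+ 2 in let x := (1 - rho) / 2 in
  let zeta w := dot (tl y) (tl w) / ht y ^+ 2 - r2 y * ht w / ht y ^+ 3 in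
  'D_u ('D_v cap) y =
    (flat 1 x / 4 + rho * flat (flatD 1) x / 8) * ht u * ht v
    - flat (flatD 1) x / 8 * dot (tl u) (tl v)
    + ht y ^+ 2 * flat (flatD (flatD 1)) x / 8 * zeta u * zeta v.
Proof.
move=> s0; have oU := open_ht_neq0.
have Uy : [set y : V | ht y != 0] y by [].
have Js := jet_ht u v oU Uy.
have J8 := jet_cst [set y : V | ht y != 0] y u v (8^-1 : R).
have J1 := jet_cst [set y : V | ht y != 0] y u v (1 : R).
have JN := jet_cst [set y : V | ht y != 0] y u v (-1 : R).
have J2 := jet_cst [set y : V | ht y != 0] y u v (2^-1 : R).
have Jss := jet_mul oU Uy Js Js.
have Ji := jet_inv oU Uy (fun z h => h) Js.
have Jr := jet_mul oU Uy (jet_r2 u v oU Uy) (jet_mul oU Uy Ji Ji).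
have Jx := jet_mul oU Uy (jet_add oU Uy J1 (jet_mul oU Uy JN Jr)) J2.
have [_ _ _] := jet_mul oU Uy (jet_mul oU Uy J8 Jss) (jet_flat oU Uy 1 Jx).
have -> : (fun z : V => 8^-1 * (ht z * ht z) *
    flat 1 ((1 + -1 * (r2 z * ((ht z)^-1 * (ht z)^-1))) * 2^-1)) = cap.
  apply/funext => z; rewrite /cap expr2 mulN1r; congr (_ * flat 1 ((_ - _ * _) / _)).
  by rewrite invfM.
move=> -> /=.
have -> : (1 + -1 * (r2 y * ((ht y)^-1 * (ht y)^-1))) * 2^-1 = (1 - r2 y / ht y ^+ 2) / 2.
  by rewrite mulN1r -invfM -expr2.
clear Jx Jr Ji Jss J2 JN J1 J8 Js.
move: (flat 1 _) (flat (flatD 1) _) (flat (flatD (flatD 1)) _) => E E1 E2.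
move: (r2 y) (dot (tl y) (tl u)) (dot (tl y) (tl v)) (dot (tl u) (tl v)) => r a b d.
move: (ht u) (ht v) => su sv.
by move: (ht y) s0 => s s0; field.
Qed.

End Coordinates.

(** * The cutoff, and the estimate for a single hole *)

Section Cutoff.
Context {R : realType}.
Implicit Types x : R.

(** The cutoff starts to decrease only at [2], well above the value [1] that bounds the band, so
    that the caps are uniformly convex wherever it varies. *)
Definition cutoff x : R := flat 1 (3 - x) / (flat 1 (3 - x) + flat 1 (x - 2)).

Lemma cutoff_denom_gt0 x : 0 < flat 1 (3 - x) + flat 1 (x - 2).
Proof.
have [x3|x3] := ltP x 3.
  by rewrite ltr_wpDr ?flat1_ge0// flat1_gt0// subr_gt0.
by rewrite ltr_wpDl ?flat1_ge0// flat1_gt0// subr_gt0 (lt_le_trans _ x3)// ltr_nat.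
Qed.

Lemma cutoff_ge0 x : 0 <= cutoff x.
Proof. by rewrite divr_ge0 ?flat1_ge0// ltW// cutoff_denom_gt0. Qed.

Lemma cutoff_eq1 x : x <= 2 -> cutoff x = 1.
Proof.
move=> x2; have := cutoff_denom_gt0 x; rewrite /cutoff (@flat_le0 _ _ (x - 2)) ?subr_le0//.
by rewrite addr0 => /lt0r_neq0 d0; rewrite divff.
Qed.

Lemma cutoff_eq0 x : 3 <= x -> cutoff x = 0.
Proof. by move=> x3; rewrite /cutoff flat_le0 ?mul0r// subr_le0. Qed.

Lemma smooth_cutoff (V : normedModType R) (U : set V) f : open U -> smooth U f ->
  smooth U (fun y => cutoff (f y)).
Proof.
move=> oU sf.
have s3 : smooth U (fun y => flat 1 (3 - f y)).
  by apply: smooth_flat => //; apply: smooth_sub_fun => //; exact: smooth_cst.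
have s2 : smooth U (fun y => flat 1 (f y - 2)).
  by apply: smooth_flat => //; apply: smooth_sub_fun => //; exact: smooth_cst.
apply: smooth_mul => //; apply: smooth_inv => //; last exact: smooth_add.
by move=> y _; rewrite gt_eqF// cutoff_denom_gt0.
Qed.

(* [2 E sw^2 + 4 s sw E1 d + 96 s^2 d^2] is [E sw^2] plus a square plus a multiple of
   [24 E - E1^2]; everything else is bounded by a multiple of [W]. *)
Lemma hessian_term_ge (E E1 E2 s sw a b h W r k d dd : R) :
  E1 ^+ 2 <= 24 * E -> 0 <= E1 <= 2 -> `|E2| <= 36 -> s ^+ 2 <= 1 ->
  a ^+ 2 <= W -> b ^+ 2 <= r * W -> h ^+ 2 <= r -> k ^+ 2 * r = 1 -> k ^+ 2 <= 3 ->
  d = k * a - k ^+ 3 * b * h ->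
  dd = 3 * k ^+ 5 * b * b * h - k ^+ 3 * W * h - k ^+ 3 * b * a - k ^+ 3 * b * a ->
  E * sw ^+ 2 - 1620 * W <=
  s ^+ 2 * (E2 * d * d + E1 * dd) + 4 * s * sw * (E1 * d) + 2 * sw ^+ 2 * E.
Proof.
move=> HE1 /andP[E1_0 E1_2] HE2 Hs Ha Hb Hh Hk Hk3 dE0 ddE0.
have k2_0 : 0 <= k ^+ 2 by exact: sqr_ge0.
(* With [k = 1/|z|], [B] is the component of the tangent vector along [z/|z|], and [t] the cosine of
   the angle between [z] and the center of the hole. *)
pose B := k * b; pose t := k * h.
have HB : B ^+ 2 <= W by rewrite /B exprMn (le_trans (ler_wpM2l k2_0 Hb))// mulrA Hk mul1r.
have Ht : t ^+ 2 <= 1 by rewrite /t exprMn (le_trans (ler_wpM2l k2_0 Hh))// Hk.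
have W0 : 0 <= W by apply: le_trans HB; exact: sqr_ge0.
have dE : d = k * (a - B * t) by rewrite dE0 /B /t; ring.
have ddE : dd = k ^+ 2 * (3 * B ^+ 2 * t - W * t - 2 * B * a) by rewrite ddE0 /B /t; ring.
have t1 : -1 <= t <= 1 by apply/andP; split; nra.
have Bt : (B * t) ^+ 2 <= W by rewrite exprMn; have := sqr_ge0 B; nra.
have Hd0 : (a - B * t) ^+ 2 <= 4 * W.
  have := sqr_ge0 (a + B * t); move: Bt; move: (B * t) => Q; nra.
have Hd : d ^+ 2 <= 12 * W.
  rewrite dE exprMn; have := sqr_ge0 (a - B * t).
  by move: Hd0; move: (_ ^+ 2) (k ^+ 2) Hk3 k2_0 => A K; nra.
have Hdd0 : `|3 * B ^+ 2 * t - W * t - 2 * B * a| <= 6 * W.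
  have Ba : `|2 * B * a| <= 2 * W.
    by rewrite ler_norml; have := sqr_ge0 (B - a); have := sqr_ge0 (B + a); nra.
  have BBt : `|3 * B ^+ 2 * t| <= 3 * W.
    by rewrite ler_norml; have := sqr_ge0 B; move: (B ^+ 2) HB => BB HB; nra.
  have Wt : `|W * t| <= W by rewrite ler_norml; nra.
  move: Ba BBt Wt; move: (2 * B * a) (3 * B ^+ 2 * t) (W * t) => x1 x2 x3.
  rewrite !ler_norml; lra.
have Hdd : `|dd| <= 18 * W.
  rewrite ddE normrM (ger0_norm k2_0); move: Hdd0 (normr_ge0 (3 * B ^+ 2 * t - W * t - 2 * B * a)).
  move: `|_| (k ^+ 2) Hk3 k2_0 => A K; nra.
have P1 : - (36 * d ^+ 2) <= E2 * d * d.
  rewrite -mulrA -expr2; move: HE2; rewrite ler_norml.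
  by have := sqr_ge0 d; move: (d ^+ 2) => D; nra.
have P2 : - (36 * W) <= E1 * dd by move: Hdd; rewrite ler_norml => /andP[h1 h2]; nra.
have P3 : - (468 * W) <= s ^+ 2 * (E2 * d * d + E1 * dd).
  have : - (468 * W) <= E2 * d * d + E1 * dd by lra.
  have := sqr_ge0 s; move: (s ^+ 2) (E2 * d * d + E1 * dd) Hs => S Q; nra.
have P4 : E * sw ^+ 2 - 96 * (s ^+ 2 * d ^+ 2) <= 4 * s * sw * (E1 * d) + 2 * sw ^+ 2 * E.
  have := sqr_ge0 (2 * s * d * 24 + sw * E1).
  have : 0 <= sw ^+ 2 * (24 * E - E1 ^+ 2) by rewrite mulr_ge0 ?sqr_ge0// subr_ge0.
  nra.
(* The constants add up as [468 = 36 * 12 + 2 * 18] and [1620 = 468 + 96 * 12]. *)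
have P5 : s ^+ 2 * d ^+ 2 <= 12 * W.
  have := sqr_ge0 s; have := sqr_ge0 d; move: (s ^+ 2) (d ^+ 2) Hs Hd => S D; nra.
lra.
Qed.

End Cutoff.

(** * The bump over the holes *)

Section Bump.
Context {R : realType} {n : nat}.
Local Notation V := 'rV[R]_(1 + n).
Variables (c : nat -> 'rV[R]_n) (gam : nat -> R).
Hypothesis hc : forall i, dot (c i) (c i) = 1.
Hypothesis gam_ge0 : forall i, 0 <= gam i.
Implicit Types (y u v w : V).

Definition dirn y : 'rV[R]_n := Defs.rad (tl y).

Definition wgt (i : nat) : R := 2^-1 ^+ i.

Lemma geo_wgt : geo_le 1 wgt.
Proof. by move=> i; rewrite mul1r /wgt ger0_norm// exprn_ge0. Qed.

Definition profile y : R := flatsum c gam wgt 1 (dirn y).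

(* At [r2 = 0] the quotient and the direction are junk values, harmless because [profile]
   vanishes there: this is where [0 <= gam i] (radii at most [pi / 2]) is used. *)
Definition bump y : R := ht y ^+ 2 * cutoff (ht y ^+ 2 / r2 y) * profile y.

Lemma flatsum_ge0 z : 0 <= flatsum c gam wgt 1 z.
Proof.
have [A HA] := geo_le_flat 1 (fun i => dot (c i) z - gam i) geo_wgt.
by apply: tsum_ge0 HA _ => i; rewrite mulr_ge0 ?flat1_ge0// exprn_ge0.
Qed.

Lemma flatsum_eq0 z : flatsum c gam wgt 1 z = 0 <-> forall i, dot (c i) z <= gam i.
Proof.
have [A HA] := geo_le_flat 1 (fun i => dot (c i) z - gam i) geo_wgt.
have F0 i : 0 <= wgt i * flat 1 (dot (c i) z - gam i).
  by rewrite mulr_ge0 ?flat1_ge0// exprn_ge0.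
split=> [g0 i|H].
  have := le_tsum i HA F0; rewrite -/(flatsum c gam wgt 1 z) g0 => le0.
  have /eqP : wgt i * flat 1 (dot (c i) z - gam i) = 0 by apply/eqP; rewrite eq_le le0 F0.
  by rewrite mulf_eq0 expf_eq0 invr_eq0 pnatr_eq0 andbF /= => /eqP/flat1_eq0; rewrite subr_le0.
rewrite -[RHS](@tsum0 R); congr tsum; apply/funext => i.
by rewrite flat_le0 ?mulr0// subr_le0.
Qed.

Lemma bump_ge0 y : 0 <= bump y.
Proof.
by apply: mulr_ge0; [apply: mulr_ge0; [exact: sqr_ge0|exact: cutoff_ge0]|exact: flatsum_ge0].
Qed.

Lemma dirnZ k y : 0 < k -> dirn (k *: y) = dirn y.
Proof.
move=> k0; rewrite /dirn /Defs.rad tlZ dotZl dotZr mulrA -expr2.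
rewrite sqrtrM ?sqr_ge0// sqrtr_sqr gtr0_norm// invfM scalerA mulrAC mulVf ?mul1r//.
by rewrite gt_eqF.
Qed.

Lemma r2Z k y : r2 (k *: y) = k ^+ 2 * r2 y.
Proof. by rewrite /r2 tlZ dotZl dotZr mulrA expr2. Qed.

Lemma ratioZ (a b k : R) : 0 < k -> (k ^+ 2 * a) / (k ^+ 2 * b) = a / b.
Proof.
by move=> k0; rewrite invfM mulrACA mulfV ?mul1r// gt_eqF// exprn_gt0.
Qed.

Lemma bumpZ k y : 0 < k -> bump (k *: y) = k ^+ 2 * bump y.
Proof.
move=> k0; rewrite /bump /profile dirnZ// r2Z htZ exprMn ratioZ//.
by rewrite !mulrA.
Qed.

Lemma capZ k y : 0 < k -> cap (k *: y) = k ^+ 2 * cap y.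
Proof. by move=> k0; rewrite /cap r2Z htZ exprMn ratioZ//; ring. Qed.

Lemma bump_eq0 y : 3 * r2 y < ht y ^+ 2 -> bump y = 0.
Proof.
move=> h; have := r2_ge0 y; rewrite le_eqVlt => /predU1P[r0|r0].
  have t0 : tl y = 0 by apply/eqP; rewrite -dotuu_eq0 -/(r2 y) -r0.
  rewrite /bump (_ : profile y = 0) ?mulr0//; apply/flatsum_eq0 => i.
  by rewrite /dirn /Defs.rad t0 scaler0 dot0r.
by rewrite /bump cutoff_eq0 ?mulr0 ?mul0r// ler_pdivlMr// ltW.
Qed.

Lemma bumpE y : 0 < 2 * r2 y + - 1 * ht y ^+ 2 -> bump y = ht y ^+ 2 * profile y.
Proof.
rewrite mulN1r subr_gt0 => h; rewrite /bump cutoff_eq1 ?mulr1//.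
have r0 : 0 < r2 y by have := sqr_ge0 (ht y); lra.
by rewrite ler_pdivrMr// ltW.
Qed.

Lemma smooth_dirn (U : set V) j : open U -> (forall y, U y -> 0 < r2 y) ->
  smooth U (fun y => dirn y 0 j).
Proof.
move=> oU r0; rewrite (_ : (fun y => _) = fun y => (Num.sqrt (r2 y))^-1 * tl y 0 j); last first.
  by apply/funext => y; rewrite /dirn /Defs.rad mxE.
apply: smooth_mul => //; last exact: smooth_tl.
apply: smooth_inv => //; first by move=> y /r0; rewrite -sqrtr_gt0 => /lt0r_neq0.
by apply: smooth_sqrt => //; exact: smooth_r2.
Qed.

Lemma smooth_profile (U : set V) : open U -> (forall y, U y -> 0 < r2 y) -> smooth U profile.
Proof.
move=> oU r0; apply: smooth_comp_row => //; first exact: smooth_flatsum geo_wgt.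
by move=> j; exact: smooth_dirn.
Qed.

(** Around the axis, on the cone [3 * r2 < ht ^ 2], the bump vanishes identically; elsewhere
    [r2 > 0], so the quotient and the direction are genuine. *)
Lemma smooth_bump : smooth (@off0 R (1 + n)) bump.
Proof.
apply: smooth_local => y y0; have := r2_ge0 y; rewrite le_eqVlt => /predU1P[r0|r0].
  exists [set y : V | 0 < - 3 * r2 y + 1 * ht y ^+ 2]; split.
    rewrite /= -r0 mulr0 add0r mul1r lt_def sqr_ge0 sqrf_eq0 andbT.
    by apply/eqP => h; have := off0_ht_r2 y0 h; rewrite -r0 ltxx.
  apply: (@smooth_eq_in _ _ _ (fun=> 0)); [exact: open_cone| |exact: smooth_cst].
  by move=> z; rewrite inE /= mul1r mulNr addrC subr_gt0 => /bump_eq0.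
exists [set y : V | 0 < 1 * r2 y + 0 * ht y ^+ 2].
have oU : open [set y : V | 0 < 1 * r2 y + 0 * ht y ^+ 2] by exact: open_cone.
have r0' z : [set y : V | 0 < 1 * r2 y + 0 * ht y ^+ 2] z -> 0 < r2 z.
  by rewrite /= mul1r mul0r addr0.
split; first by rewrite /= mul1r mul0r addr0.
have s2 : smooth [set y : V | 0 < 1 * r2 y + 0 * ht y ^+ 2] (fun y => ht y ^+ 2).
  by apply: smooth_exp => //; exact: smooth_ht.
apply: smooth_mul => //; last exact: smooth_profile.
apply: smooth_mul => //; apply: smooth_cutoff => //.
apply: smooth_mul => //; apply: smooth_inv => //; last exact: smooth_r2.
by move=> z /r0'/lt0r_neq0.
Qed.

(** On this cone the cutoff is constantly [1], so its derivatives never enter the explicit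
    computations. *)
Let UA : set V := [set y | 0 < 2 * r2 y + - 1 * ht y ^+ 2].
Let oUA : open UA. Proof. exact: open_cone. Qed.
Let UA_r2 y : UA y -> 0 < r2 y.
Proof. by rewrite /UA /= => h; have := sqr_ge0 (ht y); lra. Qed.
Let sdirn j : smooth UA (fun y => dirn y 0 j).
Proof. by apply: smooth_dirn => //; exact: UA_r2. Qed.

Lemma jet_dot_dirn (b : 'rV[R]_n) y u v (k := (Num.sqrt (r2 y))^-1) : UA y ->
  jet UA (fun z => dot b (dirn z)) y u v
   (k * dot b (tl u) - k ^+ 3 * dot (tl y) (tl u) * dot b (tl y))
   (k * dot b (tl v) - k ^+ 3 * dot (tl y) (tl v) * dot b (tl y))
   (3 * k ^+ 5 * dot (tl y) (tl u) * dot (tl y) (tl v) * dot b (tl y)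
    - k ^+ 3 * dot (tl u) (tl v) * dot b (tl y)
    - k ^+ 3 * dot (tl y) (tl u) * dot b (tl v)
    - k ^+ 3 * dot (tl y) (tl v) * dot b (tl u)).
Proof.
move=> Uy; have Jk := jet_inv_sqrt oUA Uy UA_r2 (jet_r2 u v oUA Uy).
have := jet_mul oUA Uy Jk (jet_dot_tl b u v oUA Uy).
rewrite (_ : (fun z => _ * _) = fun z => dot b (dirn z)); last first.
  by apply/funext => z; rewrite /dirn /Defs.rad dotZr.
rewrite -/k; congr jet; by field.
Qed.

Lemma profile_derive y u : UA y -> 'D_u profile y =
  tsum (fun i => wgt i * flat (flatD 1) (dot (c i) (dirn y) - gam i) *
                 'D_u (fun z => dot (c i) (dirn z)) y).
Proof. by move=> Uy; exact: (derive_flatsum_row gam hc sdirn 1 u geo_wgt Uy). Qed.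

Lemma profile_derive2 y u v : UA y -> 'D_u ('D_v profile) y =
  tsum (fun i => wgt i *
    (flat (flatD (flatD 1)) (dot (c i) (dirn y) - gam i) *
       'D_u (fun z => dot (c i) (dirn z)) y * 'D_v (fun z => dot (c i) (dirn z)) y +
     flat (flatD 1) (dot (c i) (dirn y) - gam i) *
       'D_u ('D_v (fun z => dot (c i) (dirn z))) y)).
Proof. by move=> Uy; exact: (derive2_flatsum_row gam hc oUA sdirn 1 u v geo_wgt Uy). Qed.

Lemma bump_derive2 y u v : UA y -> 'D_u ('D_v bump) y =
  ht y ^+ 2 * 'D_u ('D_v profile) y + 2 * ht y * ht u * 'D_v profile y
  + 2 * ht y * ht v * 'D_u profile y + 2 * ht u * ht v * profile y.
Proof.
move=> Uy; have E w : {in UA, 'D_w bump =1 'D_w (fun y => (ht y * ht y) * profile y)}.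
  move=> z; rewrite inE => Uz; apply: derive_eq_in oUA _ Uz => x; rewrite inE => Ux.
  by rewrite bumpE// expr2.
rewrite (derive_eq_in u oUA (E v) Uy).
have Js := jet_ht u v oUA Uy.
have Jp : jet UA profile y u v ('D_u profile y) ('D_v profile y) ('D_u ('D_v profile) y).
  by split=> //; apply: smooth_profile => //; exact: UA_r2.
have [_ _ _ ->] := jet_mul oUA Uy (jet_mul oUA Uy Js Js) Jp.
move: ('D_u ('D_v profile) y) ('D_u profile y) ('D_v profile y) => A B C.
by ring.
Qed.

(** A zero of [profile] makes every argument of [flat] nonpositive, and there all the flat functions
    vanish, those of the first and second derivatives included. *)
Lemma bump_hessian_null y u v : UA y -> profile y = 0 -> 'D_u ('D_v bump) y = 0.
Proof.
move=> Uy g0; have H i : dot (c i) (dirn y) - gam i <= 0.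
  by rewrite subr_le0; exact: (flatsum_eq0 (dirn y)).1.
rewrite bump_derive2// g0 !profile_derive// profile_derive2//.
have E (f : nat -> R) : (forall i, f i = 0) -> tsum f = 0.
  by move=> f0; rewrite -[RHS](@tsum0 R); congr tsum; apply/funext.
by rewrite !E ?mulr0 ?addr0// => i; rewrite !(flat_le0 _ (H i)) !(mul0r, mulr0, addr0).
Qed.

(** The estimate for a single hole, summed against the weights; [3240 = 2 * 1620] because the
    weights add up to [2]. *)
Lemma bump_hessian_ge y w : UA y -> sphere y ->
  ht w ^+ 2 * profile y - 3240 * r2 w <= 'D_w ('D_w bump) y.
Proof.
move=> Uy Sy; have r0 := UA_r2 Uy.
have y1 : ht y ^+ 2 + r2 y = 1 by rewrite -[RHS](Sy : dot y y = 1) dot_split expr2.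
have Uy' : 0 < 2 * r2 y + - 1 * ht y ^+ 2 by [].
pose k := (Num.sqrt (r2 y))^-1.
have k2 : k ^+ 2 * r2 y = 1.
  have s0 : Num.sqrt (r2 y) != 0 by rewrite gt_eqF// sqrtr_gt0.
  by rewrite -[X in _ * X](sqr_sqrtr (ltW r0)) /k exprVn mulVf// expf_neq0.
(* On the sphere, [ht ^ 2 < 2 * r2] forces [r2 > 1/3]. *)
have k3 : k ^+ 2 <= 3 by have := sqr_ge0 k; move: (k ^+ 2) k2 => K; nra.
pose x i := dot (c i) (dirn y) - gam i.
pose d i := 'D_w (fun z => dot (c i) (dirn z)) y.
pose dd i := 'D_w ('D_w (fun z => dot (c i) (dirn z))) y.
have [B HB] := derive_dot_bounded hc sdirn w Uy.
have [B2 HB2] := derive2_dot_bounded hc oUA sdirn w w Uy.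
have [M0 H0] := flat_bounded (1 : {poly R}).
have [M1 H1] := flat_bounded (flatD (1 : {poly R})).
have [M2 H2] := flat_bounded (flatD (flatD (1 : {poly R}))).
have G0 : geo_le (1 * M0) (fun i => wgt i * flat 1 (x i)) by apply: geo_leM geo_wgt _ => i.
have G1 : geo_le (1 * M1 * B) (fun i => wgt i * flat (flatD 1) (x i) * d i).
  by apply: geo_leM => //; apply: geo_leM geo_wgt _ => i.
have G2 : geo_le (1 * (M2 * B * B + M1 * B2)) (fun i => wgt i *
    (flat (flatD (flatD 1)) (x i) * d i * d i + flat (flatD 1) (x i) * dd i)).
  apply: geo_leM geo_wgt _ => i; rewrite (le_trans (ler_normD _ _))// !normrM.
  have := HB i; have := HB2 i; have := H1 (x i); have := H2 (x i).
  rewrite -/(d i) -/(dd i); move: (flat _ _) (flat _ _) (d i) (dd i) => a1 a2 a3 a4 h1 h2 h3 h4.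
  by apply: lerD; apply: ler_pM => //; apply: ler_pM.
have -> : 'D_w ('D_w bump) y = tsum (fun i =>
   ht y ^+ 2 * (wgt i * (flat (flatD (flatD 1)) (x i) * d i * d i + flat (flatD 1) (x i) * dd i))
   + 4 * ht y * ht w * (wgt i * flat (flatD 1) (x i) * d i)
   + 2 * ht w ^+ 2 * (wgt i * flat 1 (x i))).
  rewrite (tsumD (geo_leD (geo_leZ _ G2) (geo_leZ _ G1)) (geo_leZ _ G0)).
  rewrite (tsumD (geo_leZ _ G2) (geo_leZ _ G1)) (tsumZ _ G2) (tsumZ _ G1) (tsumZ _ G0).
  rewrite bump_derive2// profile_derive2// profile_derive// -/(profile y).
  rewrite /profile /flatsum -/x /d /dd /x.
  move: (tsum _) (tsum _) (tsum _) => a1 a2 a3; ring.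
have -> : ht w ^+ 2 * profile y - 3240 * r2 w = tsum (fun i =>
    ht w ^+ 2 * (wgt i * flat 1 (x i)) + (-1620 * r2 w) * wgt i).
  rewrite (tsumD (geo_leZ _ G0) (geo_leZ _ geo_wgt)) (tsumZ _ G0) (tsumZ _ geo_wgt).
  have -> : tsum wgt = 2.
    by rewrite -[RHS]mul1r -tsum_geo; congr tsum; apply/funext => i; rewrite mul1r.
  rewrite /profile /flatsum -/x; move: (tsum _) => a1; ring.
apply: tsum_le.
- exact: geo_leD (geo_leZ _ G0) (geo_leZ _ geo_wgt).
- exact: geo_leD (geo_leD (geo_leZ _ G2) (geo_leZ _ G1)) (geo_leZ _ G0).
move=> i; have w0 : 0 <= wgt i by rewrite exprn_ge0.
have [_ dE _ ddE] := jet_dot_dirn (c i) w w Uy.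
have T := @hessian_term_ge R (flat 1 (x i)) (flat (flatD 1) (x i))
  (flat (flatD (flatD 1)) (x i)) (ht y) (ht w) (dot (c i) (tl w)) (dot (tl y) (tl w))
  (dot (c i) (tl y)) (r2 w) (r2 y) k (d i) (dd i).
have {T}T : flat 1 (x i) * ht w ^+ 2 - 1620 * r2 w <=
  ht y ^+ 2 * (flat (flatD (flatD 1)) (x i) * d i * d i + flat (flatD 1) (x i) * dd i) +
  4 * ht y * ht w * (flat (flatD 1) (x i) * d i) + 2 * ht w ^+ 2 * flat 1 (x i).
  apply: T => //.
  - exact: flatD1_sqr_le.
  - by rewrite flatD1_ge0 flatD1_le2.
  - exact: flatDD1_norm_le.
  - by have := r2_ge0 y; lra.
  - exact: dot_unit_le.
  - exact: dot_CS.
  - exact: dot_unit_le.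
have := ler_wpM2l w0 T.
move: (flat 1 _) (flat (flatD 1) _) (flat (flatD (flatD 1)) _) (d i) (dd i) (wgt i).
move=> e e1 e2 d0 dd0 w1; lra.
Qed.

End Bump.

(** * Compactness of the sphere and bounds on Hessians *)

Section SphereCompact.
Context {R : realType} {m : nat}.
Local Notation V := 'rV[R]_m.

Lemma sphere_compact : compact (@sphere R m).
Proof.
apply: bounded_closed_compact; last first.
  have -> : @sphere R m = (fun y => dot y y) @^-1` [set 1] by [].
  apply: closed_comp; last exact: closed_eq.
  move=> y _; apply: differentiable_continuous.
  have oT : open [set: V] by exact: openT.
  have s : smooth setT (fun y : V => dot y y).
    by apply: smooth_sum => // j; apply: smooth_mul => //; exact: smooth_coord.
  exact: smooth_diff s I.
exists 1; split; first exact: num_real.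
move=> M M1 y Sy; rewrite /Num.Def.normr/= mx_normrE; apply: bigmax_le; first lra.
move=> [i j] _ /=; rewrite (ord1 i); apply: le_trans (ltW M1).
exact: unit_coord_le.
Qed.

Lemma sphere_bounded (f : V -> R) : (forall y, sphere y -> {for y, continuous f}) ->
  exists K, forall y, sphere y -> `|f y| <= K.
Proof.
move=> cf; have [[y0 Sy0]|S0] := pselect (exists y, @sphere R m y); last first.
  by exists 0 => y Sy; exfalso; apply: S0; exists y.
have cn : {within @sphere R m, continuous (fun y => `|f y|)}.
  apply: continuous_in_subspaceT => y; rewrite inE => Sy.
  by apply: continuous_comp; [exact: cf|exact: norm_continuous].
have [k Sk H] := EVT_max_rV (ex_intro _ y0 Sy0) sphere_compact cn.
by exists `|f k| => y Sy; apply: H; rewrite inE.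
Qed.

(** The second partial derivatives are continuous on the compact sphere. This serves for the bump
    near the poles, where the cutoff varies and only the size of the Hessian is needed. *)
Lemma hessian_bounded (f : V -> R) : smooth (@off0 R m) f ->
  exists2 K, 0 <= K & forall p w, sphere p -> `|'D_w ('D_w f) p| <= K * dot w w.
Proof.
move=> sf; pose e (j : 'I_m) : V := delta_mx 0 j.
have B (ij : 'I_m * 'I_m) : exists K, forall p, sphere p ->
    `|'D_(e ij.1) ('D_(e ij.2) f) p| <= K.
  apply: sphere_bounded => y Sy; apply: differentiable_continuous.
  exact: smooth_diff (smooth_derive _ (smooth_derive _ sf)) (sphere_off0 Sy).
have [K HK] := choice B.
exists (\sum_j \sum_i `|K (i, j)|) => [|p w Sp].
  by apply: sumr_ge0 => j _; apply: sumr_ge0.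
have p0 := sphere_off0 Sp; have o0 := @open_off0 R m.
have -> : 'D_w ('D_w f) p = \sum_j \sum_i w 0 j * (w 0 i * 'D_(e i) ('D_(e j) f) p).
  rewrite (derive_eq_in w o0 (g := fun y => \sum_j w 0 j * 'D_(e j) f y) _ p0); last first.
    by move=> y; rewrite inE => y0; rewrite derive_coord//; exact: smooth_diff sf y0.
  rewrite derive_dot_row => [|j]; last exact: smooth_derivable (smooth_derive _ sf) p0.
  apply: eq_bigr => j _; rewrite -mulr_sumr derive_coord//.
  exact: smooth_diff (smooth_derive _ sf) p0.
have W (j : 'I_m) : w 0 j ^+ 2 <= dot w w.
  rewrite /dot (bigD1 j)//= -expr2 lerDl sumr_ge0// => i _.
  by rewrite -expr2 sqr_ge0.
rewrite mulr_suml (le_trans (ler_norm_sum _ _ _))// ler_sum// => j _.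
rewrite mulr_suml (le_trans (ler_norm_sum _ _ _))// ler_sum// => i _.
rewrite mulrA normrM mulrC ler_pM//.
  by apply: le_trans (HK (i, j) p Sp) _; exact: ler_norm.
rewrite ler_norml; have := W i; have := W j.
have := sqr_ge0 (w 0 j - w 0 i); have := sqr_ge0 (w 0 j + w 0 i); nra.
Qed.

End SphereCompact.

(** * Convexity of the caps *)

Section CapHessian.
Context {R : realType} {n : nat}.
Local Notation V := 'rV[R]_(1 + n).
Implicit Types (y u v w : V).

Lemma cap_hessian_ge y w : ht y != 0 ->
  flat 1 ((1 - r2 y / ht y ^+ 2) / 2) / 4 * ht w ^+ 2 - r2 w / 4 <= 'D_w ('D_w cap) y.
Proof.
move=> s0; rewrite cap_hessian// -/(r2 w).
have rho0 : 0 <= r2 y / ht y ^+ 2 by rewrite divr_ge0 ?r2_ge0 ?sqr_ge0.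
move: (r2 y / ht y ^+ 2) rho0 => rho rho0.
move: (_ - _ * ht w / _) => z.
have E2 : 0 <= flat (flatD (flatD 1)) ((1 - rho) / 2) by apply: flatDD1_ge0; lra.
have E1 := flatD1_ge0 ((1 - rho) / 2); have E12 := flatD1_le2 ((1 - rho) / 2).
have q1 : 0 <= ht y ^+ 2 * flat (flatD (flatD 1)) ((1 - rho) / 2) / 8 * (z * z).
  by rewrite mulr_ge0 -?expr2 ?sqr_ge0// divr_ge0// mulr_ge0// sqr_ge0.
have q2 : 0 <= rho * flat (flatD 1) ((1 - rho) / 2) / 8 * (ht w * ht w).
  by rewrite mulr_ge0 -?expr2 ?sqr_ge0// divr_ge0// mulr_ge0.
have q3 : flat (flatD 1) ((1 - rho) / 2) / 8 * r2 w <= r2 w / 4.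
  by have := r2_ge0 w; nra.
move: q1 q2 q3; move: (flat 1 _) (flat _ _) (flat _ _) => a b d; lra.
Qed.

Lemma cap_hessian_null y u v : off0 y -> ht y ^+ 2 <= r2 y -> 'D_u ('D_v cap) y = 0.
Proof.
move=> y0 h; have [s0|s0] := eqVneq (ht y) 0; last first.
  have x0 : (1 - r2 y / ht y ^+ 2) / 2 <= 0.
    have s2 : 0 < ht y ^+ 2 by rewrite lt_def sqrf_eq0 s0 sqr_ge0.
    by rewrite pmulr_lle0// subr_le0 ler_pdivlMr// mul1r.
  by rewrite cap_hessian//= !(flat_le0 _ x0) !(mul0r, mulr0, addr0, subr0).
pose U : set V := [set y : V | 0 < 1 * r2 y + - 1 * ht y ^+ 2].
have oU : open U by exact: open_cone.
have Uy : U y by rewrite /U /= s0 expr0n mulr0 addr0 mul1r off0_ht_r2.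
have E w : {in U, 'D_w cap =1 fun=> 0}.
  move=> z; rewrite inE => Uz; rewrite -[RHS](@derive_cst _ _ _ (0 : R) z w).
  apply: derive_eq_in oU _ Uz => x; rewrite inE /U /= mul1r mulN1r subr_gt0 => /ltW.
  exact: cap_eq0.
by rewrite (derive_eq_in u oU (E v) Uy) derive_cst.
Qed.

End CapHessian.

(** * Arithmetic of the three zones: over a hole, above the band, near a pole *)

Section PositivityArithmetic.
Context {R : realType}.
Implicit Types (S W D E a b g q m eps K : R).

(** Here and below [S] stands for [ht w ^ 2] and [W] for [r2 w]. If [W > 0] the cylinder term wins;
    if [W = 0] then [S > 0], and its coefficient must be positive. *)
Lemma pos_near_hole S W D eps g : 0 < S + W -> 0 <= S -> 0 <= W -> 0 < eps -> 0 < g ->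
  W + 0 + eps * (S * g) - W / 4 <= D -> 0 < D.
Proof.
move=> SW S0 W0 e0 g0; have [r0|r0] := ltP 0 W.
  by have := mulr_ge0 (ltW e0) (mulr_ge0 S0 (ltW g0)); lra.
have sw0 : 0 < S by lra.
by have := mulr_gt0 e0 (mulr_gt0 sw0 g0); lra.
Qed.

Lemma pos_above_band S W D E a q : 0 < S + W -> 0 <= S -> 0 <= W -> 0 < E -> 0 <= q ->
  E / 4 * S - W / 4 <= a -> W + a + q - W / 4 <= D -> 0 < D.
Proof.
move=> SW S0 W0 E0 q0 H1 H2; have [r0|r0] := ltP 0 W.
  by have := mulr_ge0 (ltW E0) S0; lra.
have sw0 : 0 < S by lra.
by have := mulr_gt0 E0 sw0; lra.
Qed.

Lemma pos_near_pole S W E E0 a b m : 0 < S + W -> 0 <= S -> 0 <= W -> 0 < E0 -> E0 <= E ->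
  m <= 4^-1 -> m <= E0 / 8 -> E / 4 * S - W / 4 <= a -> - (m * (S + W)) <= b ->
  0 < W + (a + b).
Proof.
move=> SW S0 W0 E00 EE m1 m2 Ha Hb.
have h1 : m * S <= E0 / 8 * S by rewrite ler_wpM2r.
have h2 : m * W <= 4^-1 * W by rewrite ler_wpM2r.
have h3 : E0 * S <= E * S by rewrite ler_wpM2r.
have [r0|r0] := ltP 0 W; first by have := mulr_ge0 (ltW E00) S0; lra.
have sw0 : 0 < S by lra.
by have := mulr_gt0 E00 sw0; lra.
Qed.

(** [12960 = 4 * 3240] leaves a quarter of [W] to absorb the error of the bump; [m] bounds its
    Hessian near the poles and takes at most half of the coefficient [E / 4] provided by the
    caps. *)
Lemma small_eps K E : 0 <= K -> 0 < E -> exists eps m,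
  [/\ 0 < eps, 12960 * eps <= 1, eps * K <= m, m <= 4^-1 & m <= E / 8].
Proof.
move=> K0 E0; pose m := Num.min (4^-1) (E / 8).
have m0 : 0 < m by rewrite lt_min invr_gt0 divr_gt0// ltr0n.
have K1 : 0 < K + 1 by rewrite ltr_wpDl.
pose eps := Num.min (12960^-1) (m / (K + 1)).
have e0 : 0 < eps by rewrite lt_min invr_gt0 ltr0n divr_gt0.
exists eps, m; split; first exact: e0.
- by rewrite mulrC -ler_pdivlMr ?ltr0n// div1r ge_min lexx.
- have : eps <= m / (K + 1) by rewrite ge_min lexx orbT.
  rewrite ler_pdivlMr//; apply: le_trans.
  by rewrite ler_wpM2l ?lerDl// ltW.
- by rewrite ge_min lexx.
- by rewrite ge_min lexx orbT.
Qed.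

Lemma eps_absorb eps q W : 12960 * eps <= 1 -> 0 <= W ->
  eps * q - W / 4 <= eps * (q - 3240 * W).
Proof.
move=> He W0; rewrite mulrBr lerD2l lerN2.
by have := ler_wpM2r W0 He; lra.
Qed.

Lemma pos_on_band S W : S <= W -> 0 <= S -> S + W = 1 -> S < 2 * W.
Proof. by lra. Qed.

Lemma lt0_of_above S W : 2 * W <= S -> S + W = 1 -> 0 < S.
Proof. by lra. Qed.

Lemma quarter_le q : q <= 2^-1 -> 4^-1 <= (1 - q) / 2.
Proof. by lra. Qed.

Lemma half_le W : 0 <= W -> W / 2 <= W - W / 4.
Proof. by lra. Qed.

End PositivityArithmetic.

(** * The gauge function and the sign of its Hessian *)

Section GaugeFunction.
Context {R : realType} {n : nat}.
Local Notation V := 'rV[R]_(1 + n).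
Variables (c : nat -> 'rV[R]_n) (gam : nat -> R).
Hypothesis hc : forall i, dot (c i) (c i) = 1.
Hypothesis gam_ge0 : forall i, 0 <= gam i.
Implicit Types (y p u v w : V).

Definition gauge (eps : R) y : R := 2^-1 * r2 y + (cap y + eps * bump c gam y).

Definition flat_band : set V := [set y | ht y ^+ 2 <= r2 y /\ profile c gam y = 0].

Let oU := @open_off0 R (1 + n).

Lemma smooth_gauge eps : smooth (@off0 R (1 + n)) (gauge eps).
Proof.
apply: smooth_add => //; first by apply: smooth_mul => //; [exact: smooth_cst|exact: smooth_r2].
apply: smooth_add => //; first exact: smooth_cap.
by apply: smooth_mul => //; [exact: smooth_cst|exact: smooth_bump].
Qed.

Lemma gaugeZ eps k y : 0 < k -> gauge eps (k *: y) = k ^+ 2 * gauge eps y.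
Proof. by move=> k0; rewrite /gauge r2Z capZ// bumpZ//; ring. Qed.

Lemma gauge_gt0 eps y : 0 <= eps -> off0 y -> 0 < gauge eps y.
Proof.
move=> e0 y0; have b0 : 0 <= eps * bump c gam y by rewrite mulr_ge0// bump_ge0.
have c0 := cap_ge0 y; have := r2_ge0 y; rewrite le_eqVlt => /predU1P[r0|r0].
  have s0 : ht y != 0 by apply/eqP => /(off0_ht_r2 y0); rewrite -r0 ltxx.
  suff : 0 < cap y by rewrite /gauge -r0; lra.
  rewrite /cap -r0 mul0r subr0 mulr_gt0 ?flat1_gt0 ?divr_gt0//.
  by rewrite mulr_gt0 ?invr_gt0// lt_def sqrf_eq0 s0 sqr_ge0.
by rewrite /gauge; lra.
Qed.

Lemma gauge_derive2 eps y u v : off0 y -> 'D_u ('D_v (gauge eps)) y =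
  dot (tl u) (tl v) + ('D_u ('D_v cap) y + eps * 'D_u ('D_v (bump c gam)) y).
Proof.
move=> y0.
have Jof (f : V -> R) : smooth (@off0 R (1 + n)) f ->
  jet (@off0 R (1 + n)) f y u v ('D_u f y) ('D_v f y) ('D_u ('D_v f) y) by [].
have [_ _ _ ->] := jet_add oU y0
  (jet_mul oU y0 (jet_cst _ y u v (2^-1 : R)) (jet_r2 u v oU y0))
  (jet_add oU y0 (Jof _ smooth_cap)
    (jet_mul oU y0 (jet_cst _ y u v eps) (Jof _ (smooth_bump hc gam_ge0)))).
move: ('D_u ('D_v cap) y) ('D_u ('D_v (bump c gam)) y) => a b.
move: ('D_u (bump c gam) y) ('D_v (bump c gam) y) => d1 d2.
by field.
Qed.

Definition unit_ht : V := row_mx 1 0.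

Lemma ht_unit : ht unit_ht = 1.
Proof. by rewrite /ht row_mxKl mxE. Qed.

Lemma tl_unit : tl unit_ht = 0.
Proof. exact: row_mxKr. Qed.

Lemma sphere_ht_r2 p : sphere p -> ht p ^+ 2 + r2 p = 1.
Proof. by move=> Sp; rewrite -[RHS](Sp : dot p p = 1) dot_split expr2. Qed.

Lemma gauge_hessian_null eps p w : sphere p -> flat_band p ->
  'D_unit_ht ('D_w (gauge eps)) p = 0.
Proof.
move=> Sp [h g0]; have p0 := sphere_off0 Sp.
rewrite gauge_derive2// tl_unit dot0l cap_hessian_null// bump_hessian_null//.
  by rewrite mulr0 !addr0.
by have := sphere_ht_r2 Sp; rewrite /= => ?; have := sqr_ge0 (ht p); lra.
Qed.

Lemma ht_r2_gt0 w : w != 0 -> 0 < ht w ^+ 2 + r2 w.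
Proof. by rewrite -dotuu_gt0 dot_split expr2. Qed.

(* Where [ht ^ 2 < 2 * r2] the cutoff in [bump] is [1], and the only negative part of its
   Hessian is a multiple of [r2 w], absorbed by the Hessian of [r2 / 2]. Elsewhere the Hessian
   of [r2 / 2 + cap] is bounded below on the sphere. *)
Lemma gauge_hessian_sign : exists2 eps, 0 < eps &
  (forall p w, sphere p -> ~ flat_band p -> w != 0 -> 0 < 'D_w ('D_w (gauge eps)) p) /\
  (forall p w, sphere p -> flat_band p -> r2 w / 2 <= 'D_w ('D_w (gauge eps)) p).
Proof.
have [K K0 HK] := hessian_bounded (smooth_bump hc gam_ge0).
(* Where [2 * r2 <= ht ^ 2] the argument of the cap is at least [1/4], which gives a lower bound
   valid up to the poles. *)
have [E0 E00 HE0] : exists2 E0 : R, 0 < E0 & forall x, 4^-1 <= x -> E0 <= flat 1 x.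
  by exists (flat 1 4^-1) => [|x]; [rewrite flat1_gt0|exact: flat1_le].
have [eps [m [e0 e1 e2 m1 m2]]] := small_eps K0 E00.
exists eps => //.
have zoneA p w : sphere p -> ht p ^+ 2 < 2 * r2 p ->
    r2 w + 'D_w ('D_w cap) p + eps * (ht w ^+ 2 * profile c gam p) - r2 w / 4
    <= 'D_w ('D_w (gauge eps)) p.
  move=> Sp h; have p0 := sphere_off0 Sp; rewrite gauge_derive2// -/(r2 w).
  have Up : 0 < 2 * r2 p + -1 * ht p ^+ 2 by rewrite mulN1r subr_gt0.
  rewrite -!addrA lerD2l lerD2l.
  apply: le_trans (ler_wpM2l (ltW e0) (bump_hessian_ge gam hc w Up Sp)).
  exact: eps_absorb e1 (r2_ge0 w).
split=> p w Sp; have p0 := sphere_off0 Sp; have y1 := sphere_ht_r2 Sp.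
  move=> nZ w0; have wpos := ht_r2_gt0 w0; have rw := r2_ge0 w; have sw := sqr_ge0 (ht w).
  have [h|h] := ltP (ht p ^+ 2) (2 * r2 p).
    (* If [ht ^ 2 <= r2], a point off the band lies over a hole, and the positive [profile] supplies
       the vertical direction; otherwise the cap does. *)
    have := zoneA p w Sp h; have [h1|h1] := leP (ht p ^+ 2) (r2 p).
      rewrite cap_hessian_null//; apply: pos_near_hole => //.
      by rewrite lt_def flatsum_ge0 andbT; apply/eqP => g0; exact: nZ.
    have s0 : ht p != 0.
      by apply/eqP => s0; move: h1; rewrite s0 expr0n /= ltNge r2_ge0.
    have s2 : 0 < ht p ^+ 2 by rewrite lt_def sqrf_eq0 s0 sqr_ge0.
    have E : 0 < flat 1 ((1 - r2 p / ht p ^+ 2) / 2).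
      by rewrite flat1_gt0// divr_gt0// subr_gt0 ltr_pdivrMr// mul1r.
    apply: pos_above_band (cap_hessian_ge w s0) => //.
    exact: mulr_ge0 (ltW e0) (mulr_ge0 sw (flatsum_ge0 _ _ _)).
  have s2 : 0 < ht p ^+ 2 := lt0_of_above h y1.
  have s0 : ht p != 0 by rewrite -sqrf_eq0 gt_eqF.
  have E : E0 <= flat 1 ((1 - r2 p / ht p ^+ 2) / 2).
    by apply: HE0; apply: quarter_le; rewrite ler_pdivrMr// ler_pdivlMl.
  have := HK p w Sp; rewrite gauge_derive2// -/(r2 w) ler_norml => /andP[HKl _].
  apply: pos_near_pole wpos sw rw E00 E m1 m2 (cap_hessian_ge w s0) _.
  apply: le_trans (ler_wpM2l (ltW e0) HKl); rewrite mulrN lerN2 mulrA.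
  have -> : dot w w = ht w ^+ 2 + r2 w by rewrite dot_split expr2.
  exact: ler_wpM2r (ltW (ht_r2_gt0 w0)) _ _ e2.
move=> [h g0]; have h2 := pos_on_band h (sqr_ge0 _) y1.
have := zoneA p w Sp h2; rewrite cap_hessian_null// g0 !mulr0 !addr0.
by apply: le_trans; exact: half_le (r2_ge0 w).
Qed.

End GaugeFunction.

(** * The Cantor band *)

Section Band.
Context {R : realType} {n : nat}.
Implicit Types (q : 'rV[R]_n) (p : 'rV[R]_(1 + n)) (t x : R).

Lemma cos_double t : cos (2 * t) = cos t ^+ 2 - sin t ^+ 2.
Proof. by rewrite mulr_natl cos_mulr2n sin2cos2; ring. Qed.

Lemma sin2_le_cos2 t : `|t| <= pi / 4 -> sin t ^+ 2 <= cos t ^+ 2.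
Proof.
rewrite ler_norml => /andP[t1 t2]; rewrite -subr_ge0 -cos_double.
by apply: cos_ge0_pihalf; apply/andP; split; lra.
Qed.

Lemma le_pi4 t : - (pi / 2) <= t <= pi / 2 -> sin t ^+ 2 <= cos t ^+ 2 -> `|t| <= pi / 4.
Proof.
move=> /andP[t1 t2]; rewrite -subr_ge0 -cos_double => H.
have H' : 0 <= cos (2 * `|t|).
  by case: (ger0P t) => _ //; rewrite mulrN cosN.
rewrite leNgt; apply/negP => t4; move: H'; rewrite leNgt => /negP; apply.
have tp : `|t| <= pi / 2 by rewrite ler_norml t1.
have pi0 := pi_gt0 R.
have h1 : 2 * `|t| \in `[0, pi].
  by rewrite in_itv/=; apply/andP; split; [have := normr_ge0 t; lra|lra].
have h2 : (pi / 2 : R) \in `[0, pi] by rewrite in_itv/=; apply/andP; split; lra.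
by rewrite -cos_pihalf (ltr_cos h2 h1); lra.
Qed.

Lemma sphere_coord_le1 (m : nat) (c q : 'rV[R]_m) : sphere c -> sphere q -> -1 <= dot c q <= 1.
Proof.
move=> Sc Sq; have := dot_unit_le q Sc; rewrite (Sq : dot q q = 1) => H.
by apply/andP; split; nra.
Qed.

(** The cosine is strictly decreasing on [[0, pi]], so a round ball is cut out of the sphere by an
    open half-space. *)
Lemma sballP (c q : 'rV[R]_n) r : sphere c -> 0 < r <= 1 ->
  sball c r q <-> sphere q /\ cos r < dot c q.
Proof.
move=> Sc /andP[r0 r1]; have pi2 := pi_ge2 R.
have E : sphere q -> (sdist c q < r) = (cos r < dot c q).
  move=> Sq; have d1 := sphere_coord_le1 Sc Sq.
  have h1 : acos (dot c q) \in `[0, pi] by rewrite in_itv/= acos_ge0 ?acos_lepi.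
  have h2 : r \in `[0, pi] by rewrite in_itv/=; apply/andP; split; lra.
  by rewrite /sdist -(ltr_cos h1 h2) acosK ?in_itv.
by rewrite /sball /=; split=> -[Sq H]; split=> //; move: H; rewrite E.
Qed.

Lemma sphere_rad (m : nat) (y : 'rV[R]_m) : 0 < dot y y -> sphere (Defs.rad y).
Proof.
move=> y0; rewrite /sphere /Defs.rad /= dotZl dotZr -[X in _ * (_ * X)](sqr_sqrtr (ltW y0)).
have : Num.sqrt (dot y y) != 0 by rewrite gt_eqF// sqrtr_gt0.
by move: (Num.sqrt _) => s s0; field.
Qed.

(** With [ht p = sin t] and [|tl p| = cos t], the condition on [t] becomes [cos (2 t) >= 0]. *)
Lemma cantor_bandP (F : set 'rV[R]_n) p : F `<=` sphere (m := n) ->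
  (sphere p /\ ht p ^+ 2 <= r2 p /\ F (dirn p)) <-> cantor_band F (pi / 4) p.
Proof.
move=> FS; split=> [[Sp [h Fp]]|[q [t [Fq [t4 ->]]]]].
  have p1 := sphere_ht_r2 Sp; have s2 := sqr_ge0 (ht p).
  have r0 : 0 < r2 p by lra.
  have s1 : -1 <= ht p <= 1 by apply/andP; split; nra.
  have sK : sin (asin (ht p)) = ht p by rewrite asinK// in_itv.
  have cE : cos (asin (ht p)) = Num.sqrt (r2 p).
    by rewrite cos_asin//; congr Num.sqrt; lra.
  exists (dirn p), (asin (ht p)); split=> //; split.
    apply: le_pi4; first by rewrite asin_geNpi2// asin_lepi2.
    by rewrite sK cE sqr_sqrtr// ltW.
  rewrite sK cE -[LHS]hsubmxK; congr row_mx.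
    by apply/rowP => j; rewrite mxE (ord1 j).
  rewrite /dirn /Defs.rad scalerA mulfV ?scale1r// gt_eqF// sqrtr_gt0//.
have Sq : dot q q = 1 by exact: FS.
have hE : ht (row_mx (\row_(j < 1) sin t) (cos t *: q)) = sin t.
  by rewrite /ht row_mxKl mxE.
have tE : tl (row_mx (\row_(j < 1) sin t) (cos t *: q)) = cos t *: q.
  exact: row_mxKr.
have rE : r2 (row_mx (\row_(j < 1) sin t) (cos t *: q)) = cos t ^+ 2.
  by rewrite /r2 tE dotZl dotZr Sq mulr1 expr2.
have pi0 := pi_gt0 R.
have c0 : 0 < cos t.
  apply: cos_gt0_pihalf; move: t4; rewrite ler_norml => /andP[t1 t2].
  by apply/andP; split; lra.
split; first by rewrite /sphere /= dot_split -/(r2 _) hE rE -expr2 addrC cos2Dsin2.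
split; first by rewrite hE rE sin2_le_cos2.
rewrite /dirn /Defs.rad -/(r2 _) rE tE sqrtr_sqr gtr0_norm// scalerA mulVf ?scale1r//.
by rewrite gt_eqF.
Qed.

(** If [F] were empty the balls would cover the sphere. A cluster point of the centers would lie in
    some ball [j], which is open and so would contain the center of a ball of larger index, against
    disjointness. *)
Lemma good_cantor_holes (F : set 'rV[R]_n) : good_cantor 1 F ->
  F `<=` sphere (m := n) /\ F !=set0 /\
  exists c gam, [/\ forall i : nat, dot (c i) (c i) = 1, forall i, 0 <= gam i &
    forall q, sphere q -> F q <-> forall i, dot (c i) q <= gam i].
Proof.
move=> [_ [FS [c [r [cr [disj cover]]]]]].
have Sc i : sphere (c i) by have [] := cr i.
have r01 i : 0 < r i <= 1 by have [_ [-> ->]] := cr i.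
have FP q : sphere q -> F q <-> forall i, dot (c i) q <= cos (r i).
  move=> Sq; split=> [Fq i|H].
    rewrite leNgt; apply/negP => lt.
    have : (\bigcup_i sball (c i) (r i)) q by exists i => //; apply/sballP.
    by rewrite -cover => -[].
  apply: contrapT => nF; have : (sphere (m := n) `\` F) q by [].
  by rewrite cover => -[i _ /sballP -/(_ (Sc i) (r01 i))[_]]; rewrite ltNge H.
split=> //; split; last first.
  exists c, (fun i => cos (r i)); split=> // i; apply: cos_ge0_pihalf.
  have := pi_ge2 R; have /andP[r0 r1] := r01 i.
  by move=> h; apply/andP; split; lra.
apply: contrapT => F0.
have cS : (c @ \oo) (@sphere R n) by exists 0%N => // i _; exact: Sc.
have [z [Sz clz]] := sphere_compact _ cS.
have [j zj] : exists j, cos (r j) < dot (c j) z.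
  apply: contrapT => nj; apply: F0; exists z; apply/(FP z Sz) => i.
  by rewrite leNgt; apply/negP => lt; apply: nj; exists i.
have oB : open [set q : 'rV[R]_n | 0 < dot (c j) q - cos (r j)].
  have oT : open [set: 'rV[R]_n] by exact: openT.
  apply: open_gt0; apply: smooth_sub_fun => //; last exact: smooth_cst.
  by apply: (smooth_dot_row (q := id)) => // i; exact: smooth_coord.
have nB : nbhs z [set q | 0 < dot (c j) q - cos (r j)].
  by apply: open_nbhs_nbhs; split=> //=; rewrite subr_gt0.
have nA : (c @ \oo) [set q | exists2 i, (j < i)%N & q = c i].
  by exists j.+1 => // i /= ji; exists i.
have [q [[i ji ->]]] := clz _ _ nA nB.
rewrite /= subr_gt0 => h.
have ij : i <> j by move=> ij; move: ji; rewrite ij ltnn.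
have : (sball (c i) (r i) `&` sball (c j) (r j)) (c i).
  have := pi_ge2 R; have /andP[r0 r1] := r01 i => pi2.
  split; apply/sballP => //; split=> //.
  have h1 : r i \in `[0, pi] by rewrite in_itv/=; apply/andP; split; lra.
  have h2 : (0 : R) \in `[0, pi] by rewrite in_itv/= lexx pi_ge0.
  by rewrite (Sc i : dot (c i) (c i) = 1) -cos0 (ltr_cos h2 h1).
by rewrite disj.
Qed.

End Band.

(** * The immersion and its curvature *)

Unset Implicit Arguments.

Theorem theoremA (R : realType) (n : nat) (hn : (2 <= n)%N) :
  exists delta0 : R, 0 < delta0 /\
  forall F : set 'rV[R]_n, good_cantor delta0 F ->
  exists (x N : 'rV[R]_(1 + n) -> 'rV[R]_(1 + n)),
    immersion x /\ gauss_map x N /\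
    (* rank(x) = min_p rank(d_p N) = n - 1 *)
    ((forall p, sphere p -> (n.-1 <= rank_dN N p)%N) /\
     (exists p, sphere p /\ rank_dN N p = n.-1)) /\
    (forall p, sphere p -> 0 <= gauss_kronecker x N p) /\
    (exists a : R, 0 < a < pi / 2 /\
       [set p | sphere p /\ gauss_kronecker x N p = 0] = cantor_band F a).
Proof.
have m2 : (1 + n - 2)%N = n.-1 by rewrite add1n subSS subn1.
exists 1; split=> // F /good_cantor_holes[FS [[q0 Fq0] [c [gam [hc gam_ge0 FP]]]]].
have [eps e0 [Hpos Hge]] := gauge_hessian_sign hc gam_ge0.
have sL := smooth_gauge hc gam_ge0 eps.
have L0 y : off0 y -> 0 < gauge c gam eps y by exact: gauge_gt0 (ltW e0).
have Lh k y : 0 < k -> off0 y -> gauge c gam eps (k *: y) = k ^+ 2 * gauge c gam eps y.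
  by move=> k0 _; exact: gaugeZ.
have ZP p : sphere p -> flat_band c gam p <-> ht p ^+ 2 <= r2 p /\ F (dirn p).
  move=> Sp; have p1 := sphere_ht_r2 Sp; have s2 := sqr_ge0 (ht p).
  have E : ht p ^+ 2 <= r2 p -> F (dirn p) <-> profile c gam p = 0.
    move=> h; have Sq : sphere (dirn p) by apply: sphere_rad; rewrite -/(r2 p); lra.
    by rewrite (FP _ Sq); split=> /(flatsum_eq0 c gam (dirn p)).
  by split=> -[h H]; split=> //; exact/(E h).
pose Z := flat_band c gam.
have Hge0 p w : sphere p -> Z p -> 0 <= 'D_w ('D_w (gauge c gam eps)) p.
  by move=> Sp Zp; apply: le_trans (Hge p w Sp Zp); rewrite divr_ge0 ?r2_ge0.
have Heq0 p w : sphere p -> Z p -> 'D_w ('D_w (gauge c gam eps)) p = 0 ->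
    exists t, w = t *: @unit_ht R n.
  move=> Sp Zp E; have := Hge p w Sp Zp; rewrite E pmulr_lle0 ?invr_gt0// => r0.
  have /eqP : r2 w = 0 by apply/eqP; rewrite eq_le r0 r2_ge0.
  rewrite dotuu_eq0 => /eqP tw; exists (ht w); apply/eqP; rewrite -subr_eq0; apply/eqP.
  apply: ht_tl_eq0.
    by rewrite addrC -scaleNr htD ht_unit mulr1 addNr.
  by rewrite addrC -scaleNr tlD tl_unit scaler0 add0r.
have Hnull p w : sphere p -> Z p -> 'D_(@unit_ht R n) ('D_w (gauge c gam eps)) p = 0.
  by move=> Sp Zp; exact: gauge_hessian_null.
have ind p a b : sphere p -> Z p -> a *: p + b *: @unit_ht R n = 0 -> a = 0 /\ b = 0.
  move=> Sp [h _] E; have p1 := sphere_ht_r2 Sp; have s2 := sqr_ge0 (ht p).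
  have tp : tl p != 0 by rewrite -dotuu_gt0 -/(r2 p); lra.
  have := congr1 tl E; rewrite tlD tlZ tl_unit scaler0 addr0.
  have -> : tl (0 : 'rV[R]_(1 + n)) = 0 by apply/rowP => j; rewrite !mxE.
  move/eqP; rewrite scaler_eq0 (negPf tp) orbF => /eqP a0; split=> //.
  have := congr1 (@ht R n) E; rewrite a0 scale0r add0r htZ ht_unit mulr1 => ->.
  by rewrite /ht !mxE.
exists (gauge_pt (gauge c gam eps)), (gauge_normal (gauge c gam eps)).
(* A point of the equator over [F] lies in the band; there the rank attains its minimum. *)
have Sp0 : sphere (row_mx 0 q0 : 'rV[R]_(1 + n)).
  rewrite /sphere /= dot_split /ht /tl row_mxKl row_mxKr mxE mul0r add0r.
  exact: FS Fq0.
have Zp0 : Z (row_mx 0 q0).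
  apply/(ZP _ Sp0); rewrite /dirn /r2 /tl /ht row_mxKl row_mxKr mxE expr0n dotuu_ge0.
  split=> //; rewrite /Defs.rad (FS _ Fq0 : dot q0 q0 = 1) sqrtr1 invr1 scale1r.
  exact: Fq0.
split; first exact: immersion_gauge_pt.
split; first exact: gauss_map_gauge_normal.
split; first split.
- move=> p Sp.
  have := rank_dN_ge sL L0 Lh (Z := Z) Hpos Heq0 Sp.
  by rewrite m2.
- exists (row_mx 0 q0); split=> //; apply/eqP; rewrite eqn_leq.
  have := rank_dN_ge sL L0 Lh (Z := Z) Hpos Heq0 Sp0.
  have := rank_dN_le sL L0 Lh (Z := Z) Hnull ind Sp0 Zp0.
  by rewrite m2 => -> ->.
split; first by move=> p; exact: (gauss_kronecker_ge0 sL L0 Lh (Z := Z) Hpos Hge0).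
exists (pi / 4); split; first by have := pi_gt0 R; lra.
apply/seteqP; split=> p /=.
  move=> [Sp /(gauss_kronecker_eq0 sL L0 Lh (Z := Z) Hpos Hge0 Hnull ind Sp)/(ZP p Sp) H].
  by apply/cantor_bandP.
move=> /(cantor_bandP _ FS)[Sp H]; split=> //.
by apply/(gauss_kronecker_eq0 sL L0 Lh (Z := Z) Hpos Hge0 Hnull ind Sp); exact/(ZP p Sp).
Qed.
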